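(* For each $n\ge 1$ let $X_n$ be a random subcomplex of the standard simplex $\Delta_n$ on the vertex set $\{1,\dots,n\}$, distributed according to the medial regime measure $\mathbb P(X)=2^{-H(X)}$, $H(X)=|F(X)|+|E(X)|$. Then, with probability tending to $1$ as $n\to\infty$, one has $\mathsf{TC}(X_n)\le 4$.
   Context: A subcomplex $X\subseteq\Delta_n$ is any simplicial complex whose simplexes are nonempty subsets of $\{1,\dots,n\}$ (the empty complex allowed). $F(X)$ is the set of all simplexes of $X$, and $E(X)$ is the set of external simplexes of $X$: simplexes $\sigma$ of $\Delta_n$ with $\sigma\notin X$ but every proper nonempty face of $\sigma$ in $X$ (in particular, every vertex of $\Delta_n$ not in $X$ is external). The measure $\mathbb P(X)=2^{-H(X)}$ is a probability measure on the set of subcomplexes of $\Delta_n$ (it corresponds to including each vertex independently with probability $1/2$ and then, inductively in dimension, including each simplex all of whose boundary faces are present independently with probability $1/2$). For a path-connected space $Y$ (here the geometric realisation of $X$), the topological complexity $\mathsf{TC}(Y)$ is the smallest integer $k\ge 0$ such that $Y\times Y$ admits an open cover $U_0\cup U_1\cup\dots\cup U_k$ by $k+1$ open sets, each of which admits a continuous section of the path fibration $\pi:Y^{[0,1]}\to Y\times Y$, $\pi(\alpha)=(\alpha(0),\alpha(1))$, where $Y^{[0,1]}$ carries the compact-open topology (this is the normalised version, so e.g. contractible spaces have $\mathsf{TC}=0$). *)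

(* Defs.v *)
From HB Require Import structures.
From mathcomp Require Import all_boot all_order all_algebra.
From mathcomp Require Import all_classical all_reals all_analysis.

Set Implicit Arguments.
Unset Strict Implicit.
Unset Printing Implicit Defensive.

Import Order.TTheory GRing.Theory Num.Theory.
Import numFieldNormedType.Exports.

Local Open Scope classical_set_scope.
Local Open Scope ring_scope.

(* The vertex set {1,...,n} is modelled by 'I_n, a complex by the finite set
   of its simplexes; vertices need not all belong to the complex, and the
   empty complex is allowed. *)
Definition subcomplex (n : nat) (X : {set {set 'I_n}}) : bool :=
  (finset.set0 \notin X) &&
  [forall s in X, forall t : {set 'I_n},
     (t != finset.set0) && (t \subset s) ==> (t \in X)].

Definition external (n : nat) (X : {set {set 'I_n}}) : {set {set 'I_n}} :=
  [set s : {set 'I_n} | [&& s != finset.set0, s \notin X &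
     [forall t : {set 'I_n},
        (t != finset.set0) && (t \proper s) ==> (t \in X)]]]%SET.

Definition medialH (n : nat) (X : {set {set 'I_n}}) : nat :=
  (#|X| + #|external X|)%N.

Definition medial_prob (R : realType) (n : nat)
    (A : set {set {set 'I_n}}) : R :=
  \sum_(X : {set {set 'I_n}} | subcomplex X && `[< A X >]) 2 ^- medialH X.

(* Barycentric coordinates: the points of the standard simplex of R^n whose
   support is a simplex of X. *)
Definition realization_set (R : realType) (n : nat) (X : {set {set 'I_n}}) :
    set 'rV[R]_n :=
  [set x | [/\ forall i, 0 <= x ord0 i, \sum_i x ord0 i = 1 &
               [set i | x ord0 i != 0]%SET \in X]].

Arguments realization_set : clear implicits.

(* [set_type], unlike [subspace], carries the global subset topology. *)
Definition realization (R : realType) (n : nat) (X : {set {set 'I_n}}) :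
    topologicalType :=
  set_type (realization_set R n X).
Arguments realization : clear implicits.

Definition unit_interval (R : realType) : topologicalType :=
  set_type (`[0, 1]%classic : set R).

Lemma unit_interval_end0 (R : realType) : (0 : R) \in `[0, 1]%classic.
Proof. by rewrite inE /= bound_itvE. Qed.

Lemma unit_interval_end1 (R : realType) : (1 : R) \in `[0, 1]%classic.
Proof. by rewrite inE /= bound_itvE. Qed.

Definition unit0 (R : realType) : unit_interval R :=
  SigSub (unit_interval_end0 R).

Definition unit1 (R : realType) : unit_interval R :=
  SigSub (unit_interval_end1 R).

Definition path_space (R : realType) (Y : topologicalType) : Type :=
  continuousType (unit_interval R) Y.

HB.instance Definition _ (R : realType) (Y : topologicalType) :=
  Choice.on (path_space R Y).

HB.instance Definition _ (R : realType) (Y : topologicalType) :=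
  Topological.copy (path_space R Y)
    (@initial_topology (path_space R Y) {compact-open, unit_interval R -> Y}
       (@Continuous.sort _ _)).

Definition endpoints (R : realType) (Y : topologicalType)
    (a : path_space R Y) : Y * Y :=
  (Continuous.sort a (unit0 R), Continuous.sort a (unit1 R)).

Definition path_connected (R : realType) (Y : topologicalType) : Prop :=
  inhabited Y /\ forall p : Y * Y, exists a : path_space R Y, endpoints a = p.

(* A local section over U is taken as a total map, of which only the
   restriction to U is constrained. *)
Definition has_section (R : realType) (Y : topologicalType)
    (U : set (Y * Y)) : Prop :=
  exists s : Y * Y -> path_space R Y,
    {within U, continuous s} /\ {in U, cancel s (@endpoints R Y)}.

Definition section_cover (R : realType) (Y : topologicalType) (k : nat) :
    Prop :=
  exists U : 'I_k.+1 -> set (Y * Y),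
    [/\ forall i, open (U i), \bigcup_i U i = setT &
        forall i, has_section R (U i)].

Definition is_TC (R : realType) (Y : topologicalType) (k : nat) : Prop :=
  section_cover R Y k /\ forall j, section_cover R Y j -> (k <= j)%N.

(* TC is only defined for path-connected spaces, so the inequality includes
   path-connectedness. *)
Definition TC_le (R : realType) (Y : topologicalType) (m : nat) : Prop :=
  path_connected R Y /\ exists2 k, is_TC R Y k & (k <= m)%N.

(* Main.v *)
Require Import Defs.
From mathcomp Require Import all_boot all_order all_algebra.
From mathcomp Require Import all_classical all_reals all_analysis.
From mathcomp Require Import zify lra.

(* Call [X] coning of order [F] if every subcomplex with at most [F] faces (the
   empty one counted) is the base of a cone in [X].  Links of small subcomplexes
   inherit this property with a worse constant, and an induction shows that the
   skeleton of [X] on faces of at most [m] vertices is contractible in [X] as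
   soon as [3 ^ m <= F]: a point [x] first moves to its largest coordinates,
   which span a face [s]; then linearly to a point [h x] of the common link of
   [s] and of a cone vertex [v]; then linearly to [v].  The map [h] is found by
   descending induction on [s], since the link of [s * v] is as highly
   connected as needed; the factor 3 is the number of faces of a point joined
   with [v], as [2 ^ k + 1 <= 3 ^ k] for a face of [k] vertices.
   If moreover all faces have at most [2 m] vertices, [X] is the union of two
   open sets that deform into this skeleton: where at most [m] coordinates are
   large, keep these; where more than [m] are large, the upper level sets of [x]
   form a chain of at most [m] faces of sizes between [m + 1] and [2 m].  Both
   sets contract to the same point of [X], and their products give four motion
   planners, so TC is in fact at most 3.
   The medial measure is the law of the largest complex contained in a uniform
   random set [w] of simplexes.  With [3 ^ m] of order [log n], a union bound
   excludes faces of [2 m + 1] vertices, and small subcomplexes that no vertex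
   cones off (the events for different vertices being independent). *)

Set Implicit Arguments.
Unset Strict Implicit.
Unset Printing Implicit Defensive.

Import Order.TTheory GRing.Theory Num.Theory.
Import numFieldNormedType.Exports.

Local Open Scope classical_set_scope.
Local Open Scope ring_scope.

(** * Continuity on a subset *)

(** Continuity of the restriction of [f] to [A], phrased with neighbourhoods of the ambient space,
    so that [A] can shrink or be cut into pieces without a change of type. *)
Definition cont_on (S T : topologicalType) (A : set S) (f : S -> T) :=
  forall x, A x -> forall P, nbhs (f x) P -> \forall y \near x, A y -> P (f y).

(** Closedness of the trace of [C] on [A], in the relative topology of [A]. *)
Definition closed_on (S : topologicalType) (A C : set S) :=
  forall x, A x -> ~ C x -> \forall y \near x, A y -> ~ C y.

Section cont_on_theory.
Variables S T : topologicalType.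
Implicit Types (A B C : set S) (f g : S -> T).

Lemma cont_on_cvg A f :
  cont_on A f <-> forall x, A x -> f @ within A (nbhs x) --> f x.
Proof. by split=> cf x Ax P /(cf x Ax). Qed.

Lemma cont_on_subset A B f : A `<=` B -> cont_on B f -> cont_on A f.
Proof.
move=> AB cf x Ax P /(cf x (AB _ Ax)); apply: filterS => y h /AB; exact: h.
Qed.

Lemma cont_on_eq A f g : (forall x, A x -> f x = g x) ->
  cont_on A f -> cont_on A g.
Proof.
move=> fg cf x Ax P; rewrite -(fg x Ax) => /(cf x Ax).
by apply: filterS => y PA Ay; rewrite -(fg y Ay); exact: PA.
Qed.

Lemma cont_on_cst A (c : T) : cont_on A (fun=> c).
Proof. by move=> x _ P /nbhs_singleton Pc; apply: filterE. Qed.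

Lemma cont_on_id A : cont_on A id.
Proof. by move=> x _ P; apply: filterS. Qed.

Lemma continuous_cont_on A f : continuous f -> cont_on A f.
Proof.
move=> cf x _ P fP; have : nbhs x (f @^-1` P) := cf x P fP.
by apply: filterS => y.
Qed.

Lemma cont_on_continuous f : cont_on setT f -> continuous f.
Proof. by move=> cf x P /(cf x I P); apply: filterS => y; exact. Qed.

Lemma cont_on_near A f :
  (forall x, A x -> exists2 D : set S, \forall y \near x, A y -> D y &
     D x /\ cont_on (A `&` D) f) -> cont_on A f.
Proof.
move=> loc x Ax P fP; have [D nD [Dx cD]] := loc x Ax.
have nP := cD x (conj Ax Dx) P fP.
have : nbhs x ([set y | A y -> D y] `&` [set y | (A `&` D) y -> P (f y)]).
  exact: filterI nD nP.
apply: filterS => y [Dy Py] Ay.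
exact: Py (conj Ay (Dy Ay)).
Qed.

(** The pasting lemma for two relatively closed pieces: near a point outside a piece, that piece
    imposes no condition. *)
Lemma cont_on_closedU A C D f : closed_on A C -> closed_on A D ->
  (forall x, A x -> C x \/ D x) ->
  cont_on (A `&` C) f -> cont_on (A `&` D) f -> cont_on A f.
Proof.
move=> clC clD CD cC cD x Ax P fP.
have half E : closed_on A E -> cont_on (A `&` E) f ->
    \forall y \near x, A y -> E y -> P (f y).
  move=> clE cE; have [Ex|nEx] := pselect (E x).
    have := cE x (conj Ax Ex) P fP.
    by apply: filterS => y h Ay Ey; exact: h (conj Ay Ey).
  by have := clE x Ax nEx; apply: filterS => y h Ay Ey; case: (h Ay).
have : nbhs x ([set y | A y -> C y -> P (f y)] `&`
               [set y | A y -> D y -> P (f y)]).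
  exact: filterI (half _ clC cC) (half _ clD cD).
apply: filterS => y [hC hD] Ay.
by case: (CD y Ay) => ?; [exact: hC|exact: hD].
Qed.

End cont_on_theory.

Lemma cont_on_comp (S T U : topologicalType) (A : set S) (B : set T)
    (f : S -> T) (g : T -> U) :
  (forall x, A x -> B (f x)) -> cont_on A f -> cont_on B g ->
  cont_on A (fun x => g (f x)).
Proof.
move=> AB cf cg x Ax P /(cg _ (AB _ Ax)) /(cf x Ax).
by apply: filterS => y h Ay; exact: h Ay (AB _ Ay).
Qed.

Lemma cont_on_pair (S T U : topologicalType) (A : set S)
    (f : S -> T) (g : S -> U) :
  cont_on A f -> cont_on A g -> cont_on A (fun x => (f x, g x)).
Proof.
move=> /cont_on_cvg cf /cont_on_cvg cg; apply/cont_on_cvg => x Ax.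
by apply: cvg_pair; [exact: cf|exact: cg].
Qed.

Section cont_on_real.
Variables (R : realType) (S : topologicalType).
Implicit Types (A : set S) (f g : S -> R).

Lemma cont_onD A f g :
  cont_on A f -> cont_on A g -> cont_on A (fun x => f x + g x).
Proof.
move=> /cont_on_cvg cf /cont_on_cvg cg; apply/cont_on_cvg => x Ax.
by apply: cvgD; [exact: cf|exact: cg].
Qed.

Lemma cont_onB A f g :
  cont_on A f -> cont_on A g -> cont_on A (fun x => f x - g x).
Proof.
move=> /cont_on_cvg cf /cont_on_cvg cg; apply/cont_on_cvg => x Ax.
by apply: cvgB; [exact: cf|exact: cg].
Qed.

Lemma cont_onM A f g :
  cont_on A f -> cont_on A g -> cont_on A (fun x => f x * g x).
Proof.
move=> /cont_on_cvg cf /cont_on_cvg cg; apply/cont_on_cvg => x Ax.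
by apply: cvgM; [exact: cf|exact: cg].
Qed.

Lemma cont_onV A f :
  (forall x, A x -> f x != 0) -> cont_on A f -> cont_on A (fun x => (f x)^-1).
Proof.
move=> f0 /cont_on_cvg cf; apply/cont_on_cvg => x Ax.
by apply: cvgV; [exact: f0|exact: cf].
Qed.

Lemma cont_on_max A f g :
  cont_on A f -> cont_on A g -> cont_on A (fun x => Num.max (f x) (g x)).
Proof.
move=> cf cg; apply: (@cont_on_comp _ (R * R)%type _ A setT (fun x => (f x, g x))
  (fun p => Num.max p.1 p.2)).
- by [].
- exact: cont_on_pair cf cg.
- apply: continuous_cont_on => p.
  apply: (@continuous_max _ (R * R)%type fst snd p).
    exact: cvg_fst.
  exact: cvg_snd.
Qed.

Lemma cont_on_min A f g :
  cont_on A f -> cont_on A g -> cont_on A (fun x => Num.min (f x) (g x)).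
Proof.
move=> cf cg; apply: (@cont_on_comp _ (R * R)%type _ A setT (fun x => (f x, g x))
  (fun p => Num.min p.1 p.2)).
- by [].
- exact: cont_on_pair cf cg.
- apply: continuous_cont_on => p.
  apply: (@continuous_min _ (R * R)%type fst snd p).
    exact: cvg_fst.
  exact: cvg_snd.
Qed.

Lemma cont_on_sum (I : Type) (r : seq I) (P : pred I) A (F : I -> S -> R) :
  (forall i, P i -> cont_on A (F i)) ->
  cont_on A (fun x => \sum_(i <- r | P i) F i x).
Proof.
move=> cF; elim: r => [|i r IH].
  apply: (@cont_on_eq S R A (fun=> 0)) => [x _|]; first by rewrite big_nil.
  exact: cont_on_cst.
have [Pi|Pi] := boolP (P i).
  apply: cont_on_eq (cont_onD (cF i Pi) IH) => x _.
  by rewrite big_cons Pi.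
by apply: cont_on_eq IH => x _; rewrite big_cons (negbTE Pi).
Qed.

Lemma cont_on_prod (I : Type) (r : seq I) (P : pred I) A (F : I -> S -> R) :
  (forall i, P i -> cont_on A (F i)) ->
  cont_on A (fun x => \prod_(i <- r | P i) F i x).
Proof.
move=> cF; elim: r => [|i r IH].
  apply: (@cont_on_eq S R A (fun=> 1)) => [x _|]; first by rewrite big_nil.
  exact: cont_on_cst.
have [Pi|Pi] := boolP (P i).
  apply: cont_on_eq (cont_onM (cF i Pi) IH) => x _.
  by rewrite big_cons Pi.
by apply: cont_on_eq IH => x _; rewrite big_cons (negbTE Pi).
Qed.

Lemma cont_on_lt A f g x : cont_on A f -> cont_on A g -> A x ->
  f x < g x -> \forall y \near x, A y -> f y < g y.
Proof.
move=> cf cg Ax fg.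
have : \forall z \near (g x - f x), 0 < z.
  by apply: (cvgr_gt _ cvg_id); rewrite subr_gt0.
move=> /(cont_onB cg cf Ax); apply: filterS => y h Ay.
by rewrite -subr_gt0; exact: h.
Qed.

Lemma closed_on_le A f g : cont_on A f -> cont_on A g ->
  closed_on A [set x | f x <= g x].
Proof.
move=> cf cg x Ax /negP; rewrite -ltNge => gf.
have := cont_on_lt cg cf Ax gf.
by apply: filterS => y h Ay; apply/negP; rewrite -ltNge; exact: h.
Qed.

Lemma cont_on_row n A (F : S -> 'I_n -> R) :
  (forall i, cont_on A (F^~ i)) ->
  cont_on A (fun x => \row_i F x i : 'rV[R]_n).
Proof.
move=> cF x Ax P [E /= hE EP].
have : \forall y \near nbhs x, forall i, A y -> E ord0 i (F y i).
  apply: filter_forall => i.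
  by have := hE ord0 i; rewrite mxE => /(cF i x Ax).
by apply: filterS => y h Ay; apply: EP => j i; rewrite mxE ord1; exact: h.
Qed.

Lemma cont_on_coord n A (f : S -> 'rV[R]_n) i :
  cont_on A f -> cont_on A (fun x => f x ord0 i).
Proof.
move=> cf; apply: (@cont_on_comp _ _ _ A setT f (fun v => v ord0 i)) => //.
by apply: continuous_cont_on; exact: coord_continuous.
Qed.

End cont_on_real.

(** * Homotopies inside a realization *)

Section homotopic.
Variables (R : realType) (V : topologicalType).

Definition cylinder (T : topologicalType) (A : set T) : set (T * R) :=
  [set xt | A xt.1 /\ 0 <= xt.2 <= 1].

(** The homotopy is a total map with real time, constrained only over [A] and times in [0, 1]; [B]
    is the set in which it has to stay. *)
Definition homotopic (T : topologicalType) (A : set T) (B : set V)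
    (f g : T -> V) :=
  exists H : T * R -> V,
    [/\ cont_on (cylinder A) H,
        forall x t, A x -> 0 <= t <= 1 -> B (H (x, t)) &
        forall x, A x -> H (x, 0) = f x /\ H (x, 1) = g x].

Lemma homotopic_widen (T : topologicalType) (A : set T) (B B' : set V) f g :
  B `<=` B' -> homotopic A B f g -> homotopic A B' f g.
Proof.
move=> BB' [H [cH HB HE]]; exists H; split=> // x t Ax t01.
exact/BB'/HB.
Qed.

Lemma homotopic_comp (S T : topologicalType) (C : set S) (A : set T)
    (B : set V) (u : S -> T) f g :
  cont_on C u -> (forall x, C x -> A (u x)) -> homotopic A B f g ->
  homotopic C B (fun x => f (u x)) (fun x => g (u x)).
Proof.
move=> cu uA [H [cH HB HE]]; exists (fun xt => H (u xt.1, xt.2)); split.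
- apply: (@cont_on_comp _ (T * R)%type _ _ (cylinder A)
    (fun xt => (u xt.1, xt.2)) H) => //.
    by move=> [x t] [/= Cx t01]; split=> //=; exact: uA.
  apply: cont_on_pair.
    apply: (@cont_on_comp _ _ _ _ C fst u) => //; first by move=> [x t] [].
    by apply: continuous_cont_on => x; exact: cvg_fst.
  by apply: continuous_cont_on => x; exact: cvg_snd.
- by move=> x t Cx t01; apply: HB => //; exact: uA.
- by move=> x Cx; apply: HE; exact: uA.
Qed.

Lemma homotopic_sym (T : topologicalType) (A : set T) (B : set V) f g :
  homotopic A B f g -> homotopic A B g f.
Proof.
move=> [H [cH HB HE]]; exists (fun xt => H (xt.1, 1 - xt.2)); split.
- apply: (@cont_on_comp _ (T * R)%type _ _ (cylinder A)
    (fun xt : T * R => (xt.1, 1 - xt.2)) H) => //.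
    by move=> [x t] [/= Ax] t01; split=> //=; lra.
  apply: cont_on_pair; first by apply: continuous_cont_on => x; exact: cvg_fst.
  apply: cont_onB; first exact: cont_on_cst.
  by apply: continuous_cont_on => x; exact: cvg_snd.
- by move=> x t Ax t01; apply: HB => //=; lra.
- by move=> x Ax; rewrite /= subr0 subrr; have [] := HE x Ax.
Qed.

Lemma homotopic_trans (T : topologicalType) (A : set T) (B : set V) f g h :
  homotopic A B f g -> homotopic A B g h -> homotopic A B f h.
Proof.
move=> [H [cH HB HE]] [K [cK KB KE]].
pose L (xt : T * R) :=
  if xt.2 <= 2^-1 then H (xt.1, 2 * xt.2) else K (xt.1, 2 * xt.2 - 1).
have c1 D : cont_on D (fun xt : T * R => xt.1).
  by apply: continuous_cont_on => x; exact: cvg_fst.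
have c2 D : cont_on D (fun xt : T * R => xt.2).
  by apply: continuous_cont_on => x; exact: cvg_snd.
have cl D : cont_on D (fun xt : T * R => 2 * xt.2).
  by apply: cont_onM => //; exact: cont_on_cst.
exists L; split.
- apply: (@cont_on_closedU _ _ _ [set xt : T * R | xt.2 <= 2^-1]
    [set xt : T * R | 2^-1 <= xt.2]).
  + by apply: closed_on_le => //; exact: cont_on_cst.
  + by apply: closed_on_le => //; exact: cont_on_cst.
  + by move=> [x t] _ /=; apply/orP; exact: le_total.
  + apply: (@cont_on_eq _ _ _ (fun xt : T * R => H (xt.1, 2 * xt.2))).
      by move=> [x t] [_ /= t12]; rewrite /L /= t12.
    apply: (@cont_on_comp _ (T * R)%type _ _ (cylinder A)
      (fun xt : T * R => (xt.1, 2 * xt.2)) H) => //; last exact: cont_on_pair.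
    by move=> [x t] [[/= Ax t01] /= t12]; split=> //=; lra.
  + apply: (@cont_on_eq _ _ _ (fun xt : T * R => K (xt.1, 2 * xt.2 - 1))).
      move=> [x t] [[/= Ax _] /= t12]; rewrite /L /=; case: ifP => // t12'.
      have -> : t = 2^-1 by apply/le_anti; rewrite t12' t12.
      rewrite divff ?pnatr_eq0 // subrr.
      by have [_ ->] := HE x Ax; have [-> _] := KE x Ax.
    apply: (@cont_on_comp _ (T * R)%type _ _ (cylinder A)
      (fun xt : T * R => (xt.1, 2 * xt.2 - 1)) K) => //; last first.
      by apply: cont_on_pair => //; apply: cont_onB => //; exact: cont_on_cst.
    by move=> [x t] [[/= Ax t01] /= t12]; split=> //=; lra.
- move=> x t Ax t01; rewrite /L /=; case: ifPn => [t12|].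
    by apply: HB => //; lra.
  by rewrite -ltNge => t12; apply: KB => //; lra.
- move=> x Ax; rewrite /L /= mulr0 mulr1 invr_ge0 ler0n.
  have -> : (1 <= 2^-1 :> R) = false by apply/negbTE; rewrite -ltNge; lra.
  have -> : 2 - 1 = 1 :> R by lra.
  by have [-> _] := HE x Ax; have [_ ->] := KE x Ax.
Qed.

End homotopic.

(** * Simplexes, barycentric coordinates and linear homotopies *)

Section simplexes.
Variables (R : realType) (n : nat).
Implicit Types (X Y : {set {set 'I_n}}) (s t : {set 'I_n}) (x : 'rV[R]_n).

Definition in_simplex s x :=
  [/\ forall i, 0 <= x ord0 i, \sum_i x ord0 i = 1 &
      forall i, i \notin s -> x ord0 i = 0].

Definition supp x : {set 'I_n} := [set i | x ord0 i != 0]%SET.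

Lemma subcomplexP X : reflect (forall s t, s \in X -> t != finset.set0 ->
    t \subset s -> t \in X) [forall s in X, forall t : {set 'I_n},
     (t != finset.set0) && (t \subset s) ==> (t \in X)].
Proof.
apply: (iffP 'forall_implyP) => [h s t sX t0 ts|h s sX].
  by have /forallP/(_ t)/implyP := h s sX; apply; rewrite t0.
by apply/forallP => t; apply/implyP => /andP[t0 ts]; exact: h ts.
Qed.

Lemma subcomplex_sub X s t : subcomplex X -> s \in X -> t != finset.set0 ->
  t \subset s -> t \in X.
Proof. by case/andP => _ /subcomplexP h; exact: h. Qed.

Lemma subcomplex_neq0 X s : subcomplex X -> s \in X -> s != finset.set0.
Proof. by case/andP => X0 _ sX; apply: contraNneq X0 => <-. Qed.

Lemma supp_neq0 x : \sum_i x ord0 i = 1 -> supp x != finset.set0.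
Proof.
move=> x1; apply/finset.set0Pn; have [[i]|] := pselect (exists i, x ord0 i != 0).
  by exists i; rewrite finset.inE.
move=> nx; suff : (0 : R) = 1 by move/eqP; rewrite eq_sym oner_eq0.
rewrite -x1 big1 // => i _; apply/eqP/negP => xi; apply: nx; exists i.
exact/negP.
Qed.

Lemma in_simplex_supp s x : in_simplex s x -> supp x \subset s.
Proof.
move=> [_ _ xs]; apply/fintype.subsetP => i; rewrite finset.inE.
by apply: contraNT => /xs ->.
Qed.

Lemma in_simplex_subset s t x : s \subset t -> in_simplex s x -> in_simplex t x.
Proof.
move=> st [x0 x1 xs]; split=> // i it; apply: xs.
by apply: contra it; exact: (fintype.subsetP st).
Qed.

Lemma in_simplex_realization X s x :
  subcomplex X -> s \in X -> in_simplex s x -> realization_set R n X x.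
Proof.
move=> cX sX sx; have [x0 x1 _] := sx; split=> //.
exact: (subcomplex_sub cX sX (supp_neq0 x1) (in_simplex_supp sx)).
Qed.

Lemma realization_supp X x : realization_set R n X x ->
  supp x \in X /\ in_simplex (supp x) x.
Proof.
move=> [x0 x1 xX]; split=> //; split=> // i.
by rewrite finset.inE negbK => /eqP.
Qed.

Lemma realization_subset X Y : X \subset Y ->
  realization_set R n X `<=` realization_set R n Y.
Proof.
by move=> /fintype.subsetP XY x [x0 x1 xX]; split=> //; exact: XY.
Qed.

Definition vertex (i : 'I_n) : 'rV[R]_n := \row_j (j == i)%:R.

Lemma in_simplex_vertex i : in_simplex [set i]%SET (vertex i).
Proof.
split=> [j||j]; rewrite ?mxE ?ler0n //.
  rewrite (bigD1 i) //= mxE eqxx big1 ?addr0 // => j.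
  by rewrite mxE => /negbTE ->.
by rewrite finset.inE => /negbTE ->.
Qed.

Definition barycentre (w : 'I_n -> R) : 'rV[R]_n :=
  \row_i (w i / \sum_j w j).

Lemma in_simplex_barycentre s (w : 'I_n -> R) :
  (forall i, 0 <= w i) -> (exists i, 0 < w i) ->
  (forall i, i \notin s -> w i = 0) -> in_simplex s (barycentre w).
Proof.
move=> w0 [k wk] ws; have W0 : 0 < \sum_j w j.
  by rewrite (bigD1 k) //= ltr_pwDl // sumr_ge0.
split=> [i||i /ws wi]; rewrite ?mxE ?wi ?mul0r //.
  by rewrite divr_ge0 // ltW.
rewrite (eq_bigr (fun i => w i / \sum_j w j)) => [|i _]; last by rewrite mxE.
by rewrite -mulr_suml divff ?gt_eqF.
Qed.

Lemma cont_on_barycentre (T : topologicalType) (A : set T)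
    (w : T -> 'I_n -> R) :
  (forall (x : T) i, A x -> 0 <= w x i) ->
  (forall x : T, A x -> exists i, 0 < w x i) ->
  (forall i, cont_on A (w^~ i)) -> cont_on A (fun x : T => barycentre (w x)).
Proof.
move=> w0 wp cw; apply: cont_on_row => i; apply: cont_onM => //.
apply: cont_onV => [x Ax|]; last by apply: cont_on_sum.
have [k wk] := wp x Ax.
by rewrite gt_eqF // (bigD1 k) //= ltr_pwDl // sumr_ge0 // => j _; exact: w0.
Qed.

(** A closed simplex is convex, so the segment from [f x] to [g x] stays in it. The simplex may
    depend on [x] in any way, since the formula for the segment does not mention it. *)
Lemma homotopic_linear (T : topologicalType) (A : set T) X
    (f g : T -> 'rV[R]_n) :
  subcomplex X -> cont_on A f -> cont_on A g ->
  (forall x : T, A x -> exists s, [/\ s \in X, in_simplex s (f x) &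
      in_simplex s (g x)]) ->
  homotopic R A (realization_set R n X) f g.
Proof.
move=> cX cf cg fg.
exists (fun xt => \row_i ((1 - xt.2) * f xt.1 ord0 i + xt.2 * g xt.1 ord0 i)).
split.
- have c1 h : cont_on A h ->
      cont_on (@cylinder R _ A) (fun xt : T * R => h xt.1 : 'rV[R]_n).
    move=> ch; apply: (@cont_on_comp _ _ _ _ A fst h) => //.
      by move=> [x t] [].
    by apply: continuous_cont_on => x; exact: cvg_fst.
  have c2 D : cont_on D (fun xt : T * R => xt.2).
    by apply: continuous_cont_on => x; exact: cvg_snd.
  apply: cont_on_row => i; apply: cont_onD; apply: cont_onM => //.
  + by apply: cont_onB => //; exact: cont_on_cst.
  + by apply: cont_on_coord; exact: c1.
  + by apply: cont_on_coord; exact: c1.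
- move=> x t Ax /andP[t0 t1]; have [s [sX [f0 f1 fs] [g0 g1 gs]]] := fg x Ax.
  apply: in_simplex_realization cX sX _; split=> [i||i si]; rewrite ?mxE.
  + by rewrite /= addr_ge0 // mulr_ge0 // subr_ge0.
  + rewrite (eq_bigr (fun i => (1 - t) * f x ord0 i + t * g x ord0 i)).
      by rewrite big_split /= -!mulr_sumr f1 g1 !mulr1 subrK.
    by move=> i _; rewrite mxE.
  + by rewrite /= fs // gs // !mulr0 addr0.
- by move=> x Ax; split; apply/rowP => i; rewrite mxE /=
    ?subr0 ?subrr ?mul0r ?mul1r ?addr0 ?add0r.
Qed.

End simplexes.

(** * Extending maps over a chain of simplexes *)

Section carrier.
Variables (R : realType) (V : topologicalType).

(** The inclusion of [A] into [B] is null-homotopic; that [A] lies in [B] is the condition at time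
    0. *)
Definition null_in (A B : set V) :=
  exists2 p, B p & homotopic R A B id (fun=> p).

Lemma null_in_subset (A A' B B' : set V) :
  A' `<=` A -> B `<=` B' -> null_in A B -> null_in A' B'.
Proof.
move=> AA BB [p Bp HAB]; exists p; first exact: BB.
apply: (homotopic_widen BB).
apply: (@homotopic_comp R V V V A' A B id id (fun=> p)) => //.
exact: cont_on_id.
Qed.

Variables (n : nat) (T : topologicalType) (A : set T).
Variables (P : {set {set 'I_n}}) (b : {set 'I_n} -> T -> R).
Variable W : {set 'I_n} -> set V.
Hypothesis cb : forall s, cont_on A (b s).
Hypothesis b_ge0 : forall s x, A x -> 0 <= b s x.
Hypothesis b_chain : forall s t x, A x -> 0 < b s x -> 0 < b t x ->
  s \subset t \/ t \subset s.
Hypothesis bP : forall s x, A x -> 0 < b s x -> s \in P.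
Hypothesis b_pos : forall x, A x -> exists s, 0 < b s x.
Hypothesis nullW : forall s, s \in P ->
  null_in (\bigcup_(t in [set t | t \in P /\ s \proper t]) W t) (W s).

Let over (r : seq {set 'I_n}) : set T :=
  [set x | A x /\ exists2 s, s \in r & 0 < b s x].

(* The map is extended over one simplex [s] at a time, larger simplexes first:
   where [b s] is positive, the map already defined takes its values in the
   union of the [W t] over [t] containing [s], which contracts inside [W s]. *)
Let carrier_step s r (h : T -> V) : s \in P -> s \notin r -> {subset r <= P} ->
  (forall t, t \in r -> ~~ (t \proper s)) ->
  cont_on (over r) h ->
  (forall x, over r x -> exists t, [/\ t \in r, 0 < b t x & W t (h x)]) ->
  exists2 k, cont_on (over (s :: r)) k &
    forall x, over (s :: r) x ->
      exists t, [/\ t \in s :: r, 0 < b t x & W t (k x)].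
Proof.
move=> sP sr rP prs ch hW; have [p Wp [H [cH HW HE]]] := nullW sP.
set M := \bigcup_(t in _) _ in cH HW HE.
(* [B] is positive exactly on the domain of [h]. Where [D] vanishes there, only simplexes properly
   containing [s] are active, so [h] takes its values in [M] and the contraction [H] applies. *)
pose B x := \sum_(t <- r) b t x; pose D x := \sum_(t <- r | ~~ (s \proper t)) b t x.
have cB : cont_on A B by apply: cont_on_sum.
have cD : cont_on A D by apply: cont_on_sum.
have le_sum (Q : pred {set 'I_n}) t x : A x -> t \in r -> Q t ->
    b t x <= \sum_(u <- r | Q u) b u x.
  move=> Ax tr Qt; rewrite (big_rem t) //= Qt lerDl.
  by apply: sumr_ge0 => u _; exact: b_ge0.
have B_ge0 x : A x -> 0 <= B x by move=> Ax; apply: sumr_ge0 => t _; exact: b_ge0.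
have B_over x : A x -> 0 < B x -> over r x.
  move=> Ax Bx; split=> //.
  have [//|nx] := pselect (exists2 t, t \in r & 0 < b t x).
  suff : B x = 0 by move=> B0; move: Bx; rewrite B0 ltxx.
  rewrite /B big_seq big1 // => t tr; apply/le_anti; rewrite b_ge0 // andbT.
  by rewrite leNgt; apply/negP => bt; apply: nx; exists t.
have over_B x : over r x -> 0 < B x.
  by move=> [Ax [t tr bt]]; apply: lt_le_trans bt (le_sum predT t x Ax tr isT).
have D_over x : over r x -> D x <= 0 -> M (h x).
  move=> rx Dx; have [t [tr bt Wt]] := hW x rx; exists t => //; split; first exact: rP.
  have [Ax _] := rx.
  apply: contraT => st; have := le_sum (fun u => ~~ (s \proper u)) t x Ax tr st.
  by move=> /le_trans/(_ Dx); rewrite leNgt bt.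
have bs_D x : A x -> 0 < b s x -> D x <= 0.
  move=> Ax bs; rewrite /D big_seq_cond big1 // => t /andP[tr st].
  apply/le_anti; rewrite b_ge0 // andbT leNgt; apply/negP => bt.
  have st' : s != t by apply: contraNneq sr => ->.
  have [sst|tss] := b_chain Ax bs bt; first by move: st; rewrite finset.properEneq st' sst.
  by move: (prs t tr); rewrite finset.properEneq eq_sym st' tss.
(* The contraction runs for time [m], which is 0 where [b s] vanishes, so that [k] extends [h], and
   1 once [b s] reaches [B], so that [k] is already the constant [p] when [B] tends to 0. *)
pose m x := Num.min 1 (b s x / B x).
pose k x := if b s x == 0 then h x else if B x == 0 then p else H (h x, m x).
have m01 x : over r x -> 0 <= m x <= 1.
  move=> rx; rewrite /m ge_min lexx /= le_min ler01 /= divr_ge0 //.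
    by apply: b_ge0; case: rx.
  exact/ltW/over_B.
have k_top x : A x -> B x < b s x -> k x = p.
  move=> Ax Bb; have bs : 0 < b s x by apply: le_lt_trans Bb; exact: B_ge0.
  rewrite /k (gt_eqF bs); case: eqVneq => // B0.
  have Bx : 0 < B x by rewrite lt_def B0 B_ge0.
  have -> : m x = 1.
    by rewrite /m min_l // ler_pdivlMr // mul1r ltW.
  have rx := B_over x Ax Bx.
  by have [_ ->] := HE (h x) (D_over x rx (bs_D x Ax bs)).
have k_low x : over r x -> D x <= 0 -> k x = H (h x, m x).
  move=> rx Dx; rewrite /k (gt_eqF (over_B x rx)); case: eqVneq => // bs0.
  rewrite /m bs0 mul0r min_r //.
  by have [-> _] := HE (h x) (D_over x rx Dx).
exists k; last first.
  move=> x [Ax sx]; have [bs|bs] := ltP 0 (b s x).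
    exists s; rewrite mem_head; split=> //; rewrite /k (gt_eqF bs).
    case: eqVneq => // B0; have Bx : 0 < B x by rewrite lt_def B0 B_ge0.
    have rx := B_over x Ax Bx; apply: HW; last exact: m01.
    exact: D_over rx (bs_D x Ax bs).
  have bs0 : b s x = 0 by apply/le_anti; rewrite bs b_ge0.
  have rx : over r x.
    split=> //; have [t] := sx; rewrite in_cons => /orP[/eqP ->|tr] bt.
      by move: bt; rewrite bs0 ltxx.
    by exists t.
  have [t [tr bt Wt]] := hW x rx; exists t; rewrite in_cons tr orbT; split=> //.
  by rewrite /k bs0 eqxx.
have overA r' : over r' `<=` A by move=> x [].
(* Where [B] is positive, [k] is pasted from [h] on [b s <= 0] and the partial contraction on
   [D <= 0]; these sets cover because the active simplexes form a chain. Where [B] is 0, [b s]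
   exceeds [B] and [k] is locally constant. *)
apply: cont_on_near => x sx; have Ax := overA _ _ sx.
have [Bx|Bx] := ltP 0 (B x).
  exists [set y | 0 < B y].
    have := cont_on_lt (@cont_on_cst T R A 0) cB Ax Bx.
    by apply: filterS => y h' /overA; exact: h'.
  split=> //; set A1 := _ `&` _.
  have A1r : A1 `<=` over r by move=> y [/overA Ay]; exact: B_over.
  have A1A : A1 `<=` A by move=> y [/overA].
  apply: (@cont_on_closedU _ _ A1 [set y | b s y <= 0] [set y | D y <= 0]).
  - by apply: closed_on_le; [apply: cont_on_subset (@cb s)|exact: cont_on_cst].
  - by apply: closed_on_le; [apply: cont_on_subset cD|exact: cont_on_cst].
  - move=> y /A1A Ay /=; have [bs|bs] := ltP 0 (b s y); last by left.
    by right; exact: bs_D.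
  - apply: (@cont_on_eq _ _ _ h); last first.
      by apply: cont_on_subset ch => y [/A1r].
    move=> y [/A1A Ay /= bs]; rewrite /k; case: eqVneq => //.
    by move/eqP; case; apply/le_anti; rewrite bs b_ge0.
  - apply: (@cont_on_eq _ _ _ (fun y => H (h y, m y))).
      by move=> y [/A1r ry Dy]; rewrite k_low.
    apply: (@cont_on_comp _ (V * R)%type _ _ (cylinder M)
      (fun y => (h y, m y)) H) => //.
      move=> y [/A1r ry Dy]; split=> /=; last exact: m01.
      exact: D_over ry Dy.
    have cA f : cont_on A f -> cont_on (A1 `&` [set y | D y <= 0]) (f : T -> R).
      by apply: cont_on_subset => y [/A1A].
    apply: cont_on_pair.
      by apply: cont_on_subset ch => y [/A1r].
    apply: cont_on_min; first exact: cont_on_cst.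
    apply: cont_onM; first exact: cA.
    apply: cont_onV; last exact: cA.
    by move=> y [/A1r ry _]; rewrite gt_eqF //; exact: over_B.
have Bs : B x < b s x.
  apply: (le_lt_trans Bx); have [t] := sx.2.
  rewrite in_cons => /orP[/eqP -> //|tr] bt.
  have : over r x by split=> //; exists t.
  by move/over_B; rewrite ltNge Bx.
exists [set y | B y < b s y].
  have := cont_on_lt cB (@cb s) Ax Bs.
  by apply: filterS => y h' /overA; exact: h'.
split=> //; apply: (@cont_on_eq _ _ _ (fun=> p)); last exact: cont_on_cst.
by move=> y [/overA Ay Bb]; rewrite k_top.
Qed.

(** A selection result: the functions [b s] act like a partition of unity whose active members form
    a chain at each point, and [h x] is placed in [W s] for some active [s]. The contractibility
    hypothesis on [W] is what each extension consumes. *)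
Lemma carrier_map (v0 : V) :
  exists2 h : T -> V, cont_on A h &
    forall x, A x -> exists2 s, 0 < b s x & W s (h x).
Proof.
suff main r : uniq r -> {subset r <= P} ->
    pairwise (fun s t : {set 'I_n} => ~~ (t \proper s)) r ->
    exists2 h : T -> V, cont_on (over r) h &
      forall x, over r x -> exists t, [/\ t \in r, 0 < b t x & W t (h x)].
  (* In order of increasing cardinality no face comes after a face properly containing it; the
     induction starts from the end of the list, hence treats large faces first. *)
  pose le_card := relpre (fun s : {set 'I_n} => #|s|) leq.
  pose r := sort le_card (enum P).
  have memr t : (t \in r) = (t \in P) by rewrite mem_sort mem_enum.
  have [|t||h ch hW] := main r.
  - by rewrite sort_uniq enum_uniq.
  - by rewrite memr.
  - have : pairwise le_card r.
      rewrite -sorted_pairwise; last by move=> ? ? ?; exact: leq_trans.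
      by apply: sort_sorted => ? ?; exact: leq_total.
    apply: sub_pairwise => s t /= st; apply/negP => /proper_card.
    by rewrite ltnNge st.
  have Ar : A `<=` over r.
    move=> x Ax; split=> //; have [s bs] := b_pos Ax.
    by exists s => //; rewrite memr; exact: bP bs.
  exists h; first by apply: cont_on_subset ch.
  by move=> x /Ar /hW[t [_ bt Wt]]; exists t.
elim: r => [_ _ _|s r IH /= /andP[sr ur] rP /andP[/allP ps pr]].
  by exists (fun=> v0) => y [_ []].
have rP' : {subset r <= P} by move=> t tr; apply: rP; rewrite in_cons tr orbT.
have [h ch hW] := IH ur rP' pr.
by apply: (@carrier_step s r h) => //; apply: rP; rewrite mem_head.
Qed.

End carrier.

(** * Upper level sets of a point *)

Section levels.
Variables (R : realType) (n : nat) (th : R).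
Implicit Types (s t : {set 'I_n}) (x : 'rV[R]_n).

Definition excess x (i : 'I_n) : R := Num.max 0 (x ord0 i - th).

(* Positive exactly when [s] is a nonempty upper level set of [x] inside its
   support, cut out by a threshold below [th]. *)
Definition level s x : R :=
  if s == finset.set0 then 0 else
  (\prod_(i in s) x ord0 i) *
  \prod_(i in s) \prod_(j in ~: s) Num.max 0 (Num.min (x ord0 i) th - x ord0 j).

Lemma cont_on_excess (A : set 'rV[R]_n) i : cont_on A (excess^~ i).
Proof.
apply: cont_on_max; first exact: cont_on_cst.
apply: cont_onB; last exact: cont_on_cst.
by apply: (@cont_on_coord R _ n A id); exact: cont_on_id.
Qed.

Lemma excess_ge0 x i : 0 <= excess x i.
Proof. by rewrite /excess le_max lexx. Qed.

Lemma excess_gt0 x i : th < x ord0 i -> 0 < excess x i.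
Proof. by move=> xi; rewrite /excess lt_max subr_gt0 xi orbT. Qed.

Lemma excess_eq0 x i : x ord0 i <= th -> excess x i = 0.
Proof. by move=> xi; rewrite /excess max_l // subr_le0. Qed.

Lemma cont_on_level (A : set 'rV[R]_n) s : cont_on A (level s).
Proof.
rewrite /level; case: eqVneq => _; first exact: cont_on_cst.
have cc i : cont_on A (fun x : 'rV[R]_n => x ord0 i).
  by apply: (@cont_on_coord R _ n A id); exact: cont_on_id.
apply: cont_onM; apply: cont_on_prod => i _ //.
apply: cont_on_prod => j _; apply: cont_on_max; first exact: cont_on_cst.
by apply: cont_onB => //; apply: cont_on_min => //; exact: cont_on_cst.
Qed.

Lemma level_ge0 s x : (forall i, 0 <= x ord0 i) -> 0 <= level s x.
Proof.
move=> x0; rewrite /level; case: eqVneq => // _; apply: mulr_ge0.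
  by apply: prodr_ge0.
by do 2![apply: prodr_ge0 => ? _]; rewrite le_max lexx.
Qed.

Lemma level_gt0P s x : (forall i, 0 <= x ord0 i) ->
  0 < level s x <-> [/\ s != finset.set0, forall i, i \in s -> 0 < x ord0 i &
    forall i j, i \in s -> j \notin s -> x ord0 j < x ord0 i /\ x ord0 j < th].
Proof.
move=> x0; rewrite /level; case: (eqVneq s finset.set0) => [->|s0].
  by rewrite ltxx; split => // -[].
split=> [lp|[_ xs gap]].
  have := lp; rewrite lt0r mulf_eq0 negb_or.
  move=> /andP[/andP[/prodf_neq0 p1 /prodf_neq0 p2] _].
  split=> // [i si|i j si sj]; first by rewrite lt_def x0 p1.
  have /prodf_neq0 /(_ j) := p2 i si; rewrite finset.inE => /(_ sj).
  rewrite /Num.max; case: ifP => [|_]; last by rewrite eqxx.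
  by rewrite subr_gt0 lt_min => /andP.
apply: mulr_gt0; first by apply: prodr_gt0.
apply: prodr_gt0 => i si; apply: prodr_gt0 => j; rewrite finset.inE => sj.
by have [h1 h2] := gap i j si sj; rewrite lt_max subr_gt0 lt_min h1 h2 orbT.
Qed.

(** An index in [s] but not [t] and one in [t] but not [s] would each have the strictly larger
    coordinate. *)
Lemma level_chain s t x : (forall i, 0 <= x ord0 i) ->
  0 < level s x -> 0 < level t x -> s \subset t \/ t \subset s.
Proof.
move=> x0 /(level_gt0P _ x0)[_ _ gs] /(level_gt0P _ x0)[_ _ gt].
have [|/fintype.subsetPn[i si ti]] := boolP (s \subset t); first by left.
right; apply/fintype.subsetP => j tj; apply: contraT => sj.
have [+ _] := gs i j si sj; have [+ _] := gt j i tj ti.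
by move=> /lt_trans/[apply]; rewrite ltxx.
Qed.

Lemma level_top x i : (forall j, 0 <= x ord0 j) -> 0 < th -> th <= x ord0 i ->
  0 < level [set j | th <= x ord0 j]%SET x.
Proof.
move=> x0 th0 xi; apply/level_gt0P => //; split.
- by apply/finset.set0Pn; exists i; rewrite finset.inE.
- by move=> j; rewrite finset.inE; exact: lt_le_trans.
- move=> j k; rewrite !finset.inE -ltNge => xj xk; split=> //.
  exact: lt_le_trans xj.
Qed.

Lemma level_supp s x : (forall i, 0 <= x ord0 i) -> 0 < level s x ->
  s \subset supp x.
Proof.
move=> x0 /(level_gt0P _ x0)[_ xs _]; apply/fintype.subsetP => i si.
by rewrite finset.inE gt_eqF ?xs.
Qed.

(** The cap at [th] in [level] serves this purpose: every active upper level set contains all large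
    coordinates, hence carries [barycentre (excess th x)]. *)
Lemma level_mem s x i : (forall i, 0 <= x ord0 i) -> 0 < level s x ->
  th <= x ord0 i -> i \in s.
Proof.
move=> x0 /(level_gt0P _ x0)[s0 _ gap] xi; apply: contraT => si.
have /finset.set0Pn[k sk] := s0; have [_] := gap k i sk si.
by rewrite ltNge xi.
Qed.

Lemma exists_coord_ge x : \sum_i x ord0 i = 1 -> exists i, n%:R^-1 <= x ord0 i.
Proof.
move=> x1; apply: contrapT => nx.
have lt i : x ord0 i < n%:R^-1.
  by rewrite ltNge; apply/negP => xi; apply: nx; exists i.
have [n0|n0] := posnP n.
  have : (0 : R) = 1.
    by rewrite -x1 big1 // => i; have := ltn_ord i; rewrite {2}n0.
  by move/eqP; rewrite eq_sym oner_eq0.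
have : \sum_i x ord0 i < \sum_(i < n) (n%:R^-1 : R).
  by apply: ltr_sum => //; apply/hasP; exists (Ordinal n0); rewrite ?mem_index_enum.
by rewrite x1 sumr_const card_ord -[X in _ < X]mulr_natr mulVf ?ltxx // pnatr_eq0 -lt0n.
Qed.

(** Some coordinate is at least the average, which is above [th], so the total excess is positive
    and can be normalised. *)
Lemma in_simplex_excess s x : th < n%:R^-1 -> (forall i, 0 <= x ord0 i) ->
  \sum_i x ord0 i = 1 -> (forall i, th < x ord0 i -> i \in s) ->
  in_simplex s (barycentre (excess x)).
Proof.
move=> thn x0 x1 xs; apply: in_simplex_barycentre.
- exact: excess_ge0.
- have [i xi] := exists_coord_ge x1; exists i; apply: excess_gt0.
  exact: lt_le_trans xi.
- move=> i si; apply: excess_eq0; rewrite leNgt.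
  by apply: contra si; exact: xs.
Qed.

Lemma cont_on_excess_barycentre (A : set 'rV[R]_n) : th < n%:R^-1 ->
  (forall x : 'rV[R]_n, A x -> \sum_i x ord0 i = 1) ->
  cont_on A (fun x : 'rV[R]_n => barycentre (excess x)).
Proof.
move=> thn A1; apply: cont_on_barycentre.
- by move=> x i _; exact: excess_ge0.
- move=> x /A1/exists_coord_ge[i xi]; exists i; apply: excess_gt0.
  exact: lt_le_trans xi.
- by move=> i; exact: cont_on_excess.
Qed.

End levels.

(** * Skeleta, links and joins *)

Section links.
Variable n : nat.
Implicit Types (X K : {set {set 'I_n}}) (r s t : {set 'I_n}).

(** The rank [k] counts vertices, so it is one more than the dimension. *)
Definition skel k X := [set s in X | (#|s| <= k)%N]%SET.

Definition link X K :=
  [set t : {set 'I_n} | (t != finset.set0) &&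
     [forall r in K, ((r :|: t)%SET \in X) && (r :&: t == finset.set0)%SET]]%SET.

(** The faces of the join of [K] with the union of the closed simplex [s] and the point [v]; [s] and
    [v] are not joined to each other. *)
Definition cone_join K s v : {set {set 'I_n}} :=
  [set (r :|: t)%SET | r in K, t in powerset s :|: [set [set v]]]%SET.

(* [K] lists the faces of a complex, the empty face included. *)
Definition face_family X K := [/\ finset.set0 \in K,
  (forall s t, s \in K -> t \subset s -> t \in K) &
  forall s, s \in K -> s != finset.set0 -> s \in X].

Definition coning X F := forall K, face_family X K -> (#|K| <= F)%N ->
  exists v, [set v]%SET \in link X K.

Lemma linkP X K t : reflect (t != finset.set0 /\
    forall r, r \in K -> (r :|: t)%SET \in X /\ (r :&: t)%SET = finset.set0)
  (t \in link X K).
Proof.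
rewrite finset.inE; apply: (iffP andP) => -[t0 h]; split=> //.
  by move=> r rK; have /forall_inP/(_ r rK)/andP[? /eqP] := h.
by apply/forall_inP => r rK; have [-> ->] := h r rK; rewrite eqxx.
Qed.

Lemma subcomplex_link X K : subcomplex X -> subcomplex (link X K).
Proof.
move=> cX; apply/andP; split; first by rewrite finset.inE eqxx.
apply/subcomplexP => s t /linkP[s0 h] t0 ts; apply/linkP; split=> // r rK.
have [rsX drs] := h r rK; split; last first.
  by apply/eqP; rewrite -finset.subset0 -drs finset.setIS.
apply: (subcomplex_sub cX rsX); last exact: finset.setUS.
have /finset.set0Pn[i ti] := t0; apply/finset.set0Pn; exists i.
by rewrite finset.inE ti orbT.
Qed.

Lemma subcomplex_skel k X : subcomplex X -> subcomplex (skel k X).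
Proof.
move=> cX; apply/andP; split.
  by rewrite finset.inE negb_and; case/andP: cX => ->.
apply/subcomplexP => s t; rewrite !finset.inE => /andP[sX sk] t0 ts.
rewrite (subcomplex_sub cX sX t0 ts) /=.
exact: leq_trans (subset_leq_card ts) sk.
Qed.

Lemma link_subset X K K' : K' \subset K -> link X K \subset link X K'.
Proof.
move=> /fintype.subsetP KK; apply/fintype.subsetP => t /linkP[t0 h].
by apply/linkP; split=> // r /KK; exact: h.
Qed.

Lemma link_set0 X : subcomplex X -> link X [set finset.set0]%SET = X.
Proof.
move=> cX; apply/finset.setP => t; apply/linkP/idP => [[t0]|tX].
  by move=> /(_ finset.set0); rewrite finset.in_set1 eqxx finset.set0U => -[].
split; first exact: subcomplex_neq0 tX.
by move=> r; rewrite finset.in_set1 => /eqP ->; rewrite finset.set0U finset.set0I.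
Qed.

Lemma cone_joinP K s v u : reflect (exists r t, [/\ r \in K,
    t \subset s \/ t = [set v]%SET & u = (r :|: t)%SET]) (u \in cone_join K s v).
Proof.
apply: (iffP imset2P) => [[r t rK]|[r [t [rK ts ->]]]].
  rewrite finset.inE finset.powersetE finset.in_set1 => ts ->.
  by exists r, t; split=> //; case/orP: ts => [|/eqP]; [left|right].
apply: Imset2spec rK _ _ => //.
rewrite finset.inE finset.powersetE finset.in_set1.
by case: ts => [->|->]; rewrite ?eqxx ?orbT.
Qed.

Lemma card_cone_join K s v : (#|cone_join K s v| <= #|K| * (2 ^ #|s|).+1)%N.
Proof.
rewrite /cone_join curry_imset2X (leq_trans (leq_imset_card _ _)) // cardsX.
rewrite leq_mul2l; apply/orP; right.
by rewrite -card_powerset -addn1 -(cards1 [set v]%SET) leq_card_setU.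
Qed.

Lemma cone_join_subset K s t v : s \subset t ->
  cone_join K s v \subset cone_join K t v.
Proof.
move=> st; apply/fintype.subsetP => u /cone_joinP[r [w [rK ws ->]]].
apply/cone_joinP; exists r, w; split=> //; case: ws => [ws|]; last by right.
by left; exact: fintype.subset_trans ws st.
Qed.

Lemma face_family_cone_join X K s v : face_family X K -> subcomplex X ->
  s \in link X K -> [set v]%SET \in link X K -> face_family X (cone_join K s v).
Proof.
move=> [K0 Kd KX] cX /linkP[s0 sK] /linkP[_ vK].
have set1_sub t : t \subset [set v]%SET -> t = finset.set0 \/ t = [set v]%SET.
  by rewrite finset.subset1 => /orP[] /eqP ->; [right|left].
split.
- apply/cone_joinP; exists finset.set0, finset.set0; split=> //.
    by left; exact: finset.sub0set.
  by rewrite finset.setU0.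
- move=> u w /cone_joinP[r [t [rK ts ->]]] wrt; apply/cone_joinP.
  exists (w :&: r)%SET, (w :&: t)%SET; split.
  + by apply: (Kd _ _ rK); exact: finset.subsetIr.
  + case: ts => [ts|tv].
      by left; apply: fintype.subset_trans ts; exact: finset.subsetIr.
    have wt : (w :&: t)%SET \subset [set v]%SET by rewrite -tv finset.subsetIr.
    have [->|->] := set1_sub _ wt.
    * by left; exact: finset.sub0set.
    * by right.
  + by rewrite -finset.setIUr; apply/esym/finset.setIidPl.
- move=> u /cone_joinP[r [t [rK [ts|->] ->]]] u0; last by have [] := vK r rK.
  have [rsX _] := sK r rK.
  by apply: (subcomplex_sub cX rsX u0); exact: finset.setUS.
Qed.

(** For [r] in [K], the face [r :|: w] belongs to the join, so [t] can be added to it. Thus a point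
    of the smaller link spans a simplex of [link X K] with any face of [s], and also with [v]. *)
Lemma link_cone_join X K s v t w : subcomplex X -> t \in link X (cone_join K s v) ->
  finset.set0 \in K -> w \in link X K -> w \subset s \/ w = [set v]%SET ->
  (w :|: t)%SET \in link X K.
Proof.
move=> cX /linkP[t0 ht] K0 /linkP[w0 hw] ws; apply/linkP; split.
  have /finset.set0Pn[i ti] := t0; apply/finset.set0Pn; exists i.
  by rewrite finset.inE ti orbT.
move=> r rK; have [|rwX rwt] := ht (r :|: w)%SET.
  by apply/cone_joinP; exists r, w.
rewrite finset.setUA; split=> //.
have [_ drw] := hw r rK.
rewrite finset.setIUr drw finset.set0U; apply/eqP.
by rewrite -finset.subset0 -rwt finset.setSI // finset.subsetUl.
Qed.

End links.

(** * Contracting skeleta of links *)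

Section contraction.
Variables (R : realType) (n : nat).
Implicit Types (X Y K : {set {set 'I_n}}) (r s t : {set 'I_n}).

Lemma mem_skel k X s : (s \in skel k X) = (s \in X) && (#|s| <= k)%N.
Proof. by rewrite /skel finset.inE. Qed.

Lemma skel_subset k l X Y : (k <= l)%N -> X \subset Y -> skel k X \subset skel l Y.
Proof.
move=> kl /fintype.subsetP XY; apply/fintype.subsetP => s.
by rewrite !mem_skel => /andP[/XY -> /leq_trans]; exact.
Qed.

Lemma in_simplexU s t (x y : 'rV[R]_n) : in_simplex s x -> in_simplex t y ->
  in_simplex (s :|: t)%SET x /\ in_simplex (s :|: t)%SET y.
Proof.
move=> sx ty; split; [apply: in_simplex_subset sx|apply: in_simplex_subset ty].
  exact: finset.subsetUl.
exact: finset.subsetUr.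
Qed.

(** Strong induction on [k] for all [K] at once: for a face [s], the hypothesis at rank [k - #|s|]
    is used for the join of [K] with [s] and [v], and provides the contractions that [carrier_map]
    needs. *)
Lemma skel_link_null X F : subcomplex X -> coning X F -> forall k K,
  face_family X K -> (#|K| * 3 ^ k <= F)%N ->
  null_in R (realization_set R n (skel k (link X K)))
            (realization_set R n (skel k.+1 (link X K))).
Proof.
move=> cX coneX; elim/ltn_ind => k IH K KK KF.
have cL : subcomplex (link X K) by exact: subcomplex_link.
have K0 : finset.set0 \in K by case: KK.
have [v vL] : exists v, [set v]%SET \in link X K.
  by apply: coneX => //; apply: leq_trans KF; rewrite leq_pmulr ?expn_gt0.
have vS : [set v]%SET \in skel k.+1 (link X K).
  by rewrite mem_skel vL cards1.
have cS : subcomplex (skel k.+1 (link X K)) by exact: subcomplex_skel.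
exists (vertex R v).
  exact: in_simplex_realization cS vS (in_simplex_vertex R v).
pose A := realization_set R n (skel k (link X K)).
pose U s := skel (k - #|s|).+1 (link X (cone_join K s v)).
(* Any positive threshold below [1 / n] would do. *)
pose th : R := (n.+1)%:R^-1.
have n0 : (0 < n)%N by apply: leq_ltn_trans (ltn_ord v).
have th0 : 0 < th by rewrite invr_gt0 ltr0n.
have thn : th < n%:R^-1 by rewrite ltf_pV2 ?posrE ?ltr0n // ltr_nat.
have A_ge0 x : A x -> forall i, 0 <= x ord0 i by case.
have A_sum x : A x -> \sum_i x ord0 i = 1 by case.
have A_supp x : A x -> supp x \in skel k (link X K) /\ in_simplex (supp x) x.
  exact: realization_supp.
have nullU s : s \in skel k (link X K) -> null_in R
    (\bigcup_(t in [set t | t \in skel k (link X K) /\ s \proper t])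
       realization_set R n (U t)) (realization_set R n (U s)).
  move=> sL; have := sL; rewrite mem_skel => /andP[sl sk].
  have s0 : (0 < #|s|)%N by rewrite card_gt0; exact: subcomplex_neq0 sl.
  have /IH : (k - #|s| < k)%N by rewrite ltn_subrL s0 (leq_trans s0).
  move=> /(_ (cone_join K s v)) nullK.
  apply: null_in_subset (nullK _ _) => //.
  (* A face [t] properly containing [s] has at least one more vertex, which absorbs the successor in
     the rank of [U t]. *)
  - move=> x [t [+ st]]; rewrite mem_skel => /andP[tl tk].
    apply: realization_subset; apply: skel_subset.
      by have := proper_card st; lia.
    by apply: link_subset; apply: cone_join_subset; exact: proper_sub.
  - exact: face_family_cone_join.
  - apply: leq_trans KF; apply: (@leq_trans (#|K| * (2 ^ #|s|).+1 * 3 ^ (k - #|s|))).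
      by rewrite leq_mul2r card_cone_join orbT.
    rewrite -mulnA leq_mul2l; apply/orP; right.
    (* The budget splits as [3 ^ #|s|] times [3 ^ (k - #|s|)], and [2 ^ j + 1 <= 3 ^ j] for [j]
       positive. *)
    rewrite -[X in (_ <= 3 ^ X)%N](subnKC sk) expnD leq_mul2r; apply/orP; right.
    elim: (#|s|) s0 => // -[_ _ //|j IHj _].
    by have := IHj isT; rewrite [(2 ^ j.+2)%N]expnS [(3 ^ j.+2)%N]expnS; lia.
have [||||||h ch hU] := @carrier_map R 'rV[R]_n n 'rV[R]_n A
    (skel k (link X K)) (level th) (fun s => realization_set R n (U s)) _ _ _ _ _ _ 0.
- by move=> s; exact: cont_on_level.
- by move=> s x /A_ge0 x0; exact: level_ge0.
- by move=> s t x /A_ge0 x0; exact: level_chain.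
- move=> s x Ax bs; have [sX _] := A_supp x Ax; have x0 := A_ge0 x Ax.
  apply: (subcomplex_sub (subcomplex_skel k cL) sX); last exact: level_supp bs.
  by have [] := (level_gt0P th s x0).1 bs.
- move=> x Ax; have [i xi] := exists_coord_ge (A_sum x Ax).
  exists [set j | th <= x ord0 j]%SET; apply: (level_top (i := i)) => //.
    exact: A_ge0.
  exact: le_trans (ltW thn) xi.
- exact: nullU.
have ca : cont_on A (fun x => barycentre (excess th x)).
  exact: cont_on_excess_barycentre.
have hS x : A x -> exists s t, [/\ s \in skel k (link X K),
    in_simplex s (barycentre (excess th x)), t \in U s & in_simplex t (h x)].
  move=> Ax; have [s bs /realization_supp[hx hs]] := hU x Ax.
  have x0 := A_ge0 x Ax; exists s, (supp (h x)); split=> //.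
    have [sX _] := A_supp x Ax.
    apply: (subcomplex_sub (subcomplex_skel k cL) sX); last exact: level_supp bs.
    by have [] := (level_gt0P th s x0).1 bs.
  apply: in_simplex_excess => //; first exact: A_sum.
  by move=> i xi; apply: level_mem bs _ => //; exact: ltW.
(* Three linear homotopies: from [x] to its large coordinates, from there to [h x], and from [h x]
   to the vertex [v]. *)
apply: (@homotopic_trans _ _ _ _ _ _ (fun x => barycentre (excess th x))).
  apply: homotopic_linear => //; first exact: cont_on_id.
  move=> x Ax; have [xS sx] := A_supp x Ax; exists (supp x); split=> //.
    by apply: (fintype.subsetP (skel_subset (leqnSn k) (fintype.subxx _))).
  apply: in_simplex_excess => //; [exact: A_ge0|exact: A_sum|].
  by move=> i xi; rewrite finset.inE gt_eqF // (lt_trans th0).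
apply: (@homotopic_trans _ _ _ _ _ _ h).
  apply: homotopic_linear => // x Ax; have [s [t [sL sx tU tx]]] := hS x Ax.
  exists (s :|: t)%SET; have [sx' tx'] := in_simplexU sx tx; split=> //.
  move: sL tU; rewrite !mem_skel => /andP[sL sk] /andP[tL tk].
  rewrite (link_cone_join cX tL) //=; last by left.
  rewrite (leq_trans (leq_card_setU _ _)) //.
  (* The count is [#|s| + (k - #|s|) + 1], which equals [k + 1] as [#|s| <= k]. *)
  by apply: leq_trans (leq_add (leqnn _) tk) _; lia.
apply: homotopic_linear => //; first exact: cont_on_cst.
move=> x Ax; have [s [t [sL _ tU tx]]] := hS x Ax.
have [vx tx'] := in_simplexU (in_simplex_vertex R v) tx.
exists ([set v] :|: t)%SET; split=> //.
move: sL tU; rewrite !mem_skel => /andP[sL sk] /andP[tL tk].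
have s0 : (0 < #|s|)%N by rewrite card_gt0; exact: subcomplex_neq0 sL.
rewrite (link_cone_join cX tL) //=; last by right.
rewrite (leq_trans (leq_card_setU _ _)) // cards1.
(* The vertex [v] fits within rank [k + 1] because [s] is nonempty. *)
by apply: leq_trans (leq_add (leqnn _) tk) _; lia.
Qed.

End contraction.

(** * Two contractible open sets *)

Section two_contractible_opens.
Variables (R : realType) (n : nat) (X : {set {set 'I_n}}) (F m : nat).
Hypotheses (cX : subcomplex X) (coneX : coning X F) (mF : (3 ^ m <= F)%N).
Hypothesis dimX : forall s, s \in X -> (#|s| <= 2 * m)%N.

Let rX := realization_set R n X.

(** The case where [K] contains only the empty face: its link is all of [X]. *)
Lemma skel_null : null_in R (realization_set R n (skel m X)) rX.
Proof.
have := @skel_link_null R n X F cX coneX m [set finset.set0]%SET.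
rewrite link_set0 // cards1 mul1n => /(_ _ mF) h.
apply: null_in_subset (h _) => //.
  by apply: realization_subset; apply/fintype.subsetP => s; rewrite mem_skel => /andP[].
split; first by rewrite finset.in_set1.
  by move=> s t; rewrite !finset.in_set1 => /eqP ->; rewrite finset.subset0.
by move=> s; rewrite finset.in_set1 => ->.
Qed.

Lemma homotopic_skel_cst (A : set 'rV[R]_n) (u : 'rV[R]_n -> 'rV[R]_n) p :
  A `<=` rX -> cont_on A u ->
  (forall x, A x -> exists t, [/\ in_simplex t (u x), t \subset supp x &
      (#|t| <= m)%N]) ->
  homotopic R (realization_set R n (skel m X)) rX id (fun=> p) ->
  homotopic R A rX id (fun=> p).
Proof.
move=> AX cu hu np; apply: (@homotopic_trans _ _ _ _ _ _ u).
  apply: homotopic_linear => //; first exact: cont_on_id.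
  move=> x Ax; have [t [ut tx _]] := hu x Ax.
  have [xX sx] := realization_supp (AX _ Ax); exists (supp x); split=> //.
  exact: in_simplex_subset ut.
apply: homotopic_comp np => //.
move=> x Ax; have [t [ut tx tm]] := hu x Ax.
have [xX sx] := realization_supp (AX _ Ax); have [_ u1 _] := ut.
apply: (in_simplex_realization (s := supp (u x))).
- exact: subcomplex_skel.
- rewrite mem_skel (leq_trans (subset_leq_card (in_simplex_supp ut)) tm) andbT.
  apply: (subcomplex_sub cX xX); first exact: supp_neq0.
  exact: fintype.subset_trans (in_simplex_supp ut) tx.
- by split=> // [i|i]; [case: ut|rewrite finset.inE negbK => /eqP].
Qed.

(** Positive exactly when at most [m] coordinates are at least [th]: every larger set of indices
    contains one with a smaller coordinate. *)
Definition few_large (th : R) (x : 'rV[R]_n) : R :=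
  \prod_(S : {set 'I_n} | (m < #|S|)%N) \sum_(i in S) Num.max 0 (th - x ord0 i).

(** Positive exactly when more than [m] coordinates exceed [th]. *)
Definition many_large (th : R) (x : 'rV[R]_n) : R :=
  \sum_(S : {set 'I_n} | (m < #|S|)%N) \prod_(i in S) excess th x i.

Lemma cont_on_few_large th (A : set 'rV[R]_n) : cont_on A (few_large th).
Proof.
apply: cont_on_prod => S _; apply: cont_on_sum => i _.
apply: cont_on_max; first exact: cont_on_cst.
apply: cont_onB; first exact: cont_on_cst.
by apply: (@cont_on_coord R _ n A id); exact: cont_on_id.
Qed.

Lemma cont_on_many_large th (A : set 'rV[R]_n) : cont_on A (many_large th).
Proof.
by apply: cont_on_sum => S _; apply: cont_on_prod => i _; exact: cont_on_excess.
Qed.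

(** Two thresholds make the open conditions overlap: if more than [m] coordinates are at least [th],
    these all exceed [th'] strictly. *)
Lemma few_or_many_large th th' x : th' < th ->
  0 < few_large th x \/ 0 < many_large th' x.
Proof.
move=> tt; pose L := [set i | th <= x ord0 i]%SET.
have [Lm|Lm] := leqP #|L| m.
  left; apply: prodr_gt0 => S mS.
  have /fintype.subsetPn[i iS iL] : ~~ (S \subset L).
    by apply: contraL mS => /subset_leq_card/leq_trans/(_ Lm); rewrite -leqNgt.
  rewrite (bigD1 i) //= ltr_pwDl ?sumr_ge0 // => [|j _]; last by rewrite le_max lexx.
  by move: iL; rewrite finset.inE -ltNge => xi; rewrite lt_max subr_gt0 xi orbT.
right; rewrite /many_large (bigD1 L) //= ltr_pwDl //.
  apply: prodr_gt0 => i; rewrite finset.inE => iL.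
  by apply: excess_gt0; exact: lt_le_trans iL.
by apply: sumr_ge0 => S _; apply: prodr_ge0 => i _; exact: excess_ge0.
Qed.

Lemma few_large_homotopic th p : 0 < th -> th < n%:R^-1 ->
  homotopic R (realization_set R n (skel m X)) rX id (fun=> p) ->
  homotopic R (rX `&` [set x | 0 < few_large th x]) rX id (fun=> p).
Proof.
move=> th0 thn.
apply: (homotopic_skel_cst (u := fun x => barycentre (excess th x)))
  => [x []//||x [[x0 x1 _] fx]].
  by apply: cont_on_excess_barycentre => // x [[]].
exists [set i | th < x ord0 i]%SET; split.
- by apply: in_simplex_excess => // i xi; rewrite finset.inE.
- apply/fintype.subsetP => i; rewrite !finset.inE => xi.
  by rewrite gt_eqF // (lt_trans th0).
- rewrite leqNgt; apply/negP => mS.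
  suff f0 : few_large th x = 0 by move: fx => /=; rewrite f0 ltxx.
  apply/eqP/prodf_eq0; exists [set i | th < x ord0 i]%SET => //.
  rewrite big1 // => i; rewrite finset.inE => xi.
  by rewrite max_l // subr_le0 ltW.
Qed.

(** Cardinality is injective on a chain, and only [m] values are available. *)
Lemma chain_card_le (L : {set {set 'I_n}}) :
  {in L &, forall s t : {set 'I_n}, s \subset t \/ t \subset s} ->
  {in L, forall s : {set 'I_n}, (m < #|s| <= 2 * m)%N} -> (#|L| <= m)%N.
Proof.
move=> chL dL; have injL : {in enum L &, injective (fun s : {set 'I_n} => #|s|)}.
  move=> s t; rewrite !mem_enum => sL tL st; apply/eqP.
  by have [|] := chL s t sL tL => h; [|rewrite eq_sym]; rewrite eqEcard h st /=.
rewrite cardE -(size_map (fun s : {set 'I_n} => #|s|)) -[leqRHS](size_iota m.+1).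
apply: uniq_leq_size; first by rewrite map_inj_in_uniq ?enum_uniq.
move=> _ /mapP[s + ->]; rewrite mem_enum mem_iota => /dL; lia.
Qed.

(** Each active upper level set is replaced by a chosen vertex of it, weighted by its [level]. The
    active sets form a chain, so at most [m] vertices occur, all in the support of [x]. The index
    [i0] is the default choice for the empty set. *)
Lemma many_large_homotopic (i0 : 'I_n) th p : 0 < th -> th < n%:R^-1 ->
  homotopic R (realization_set R n (skel m X)) rX id (fun=> p) ->
  homotopic R (rX `&` [set x | 0 < many_large th x]) rX id (fun=> p).
Proof.
move=> th0 thn.
pose pk (s : {set 'I_n}) := odflt i0 [pick i in s].
have pkP s : s != finset.set0 -> pk s \in s.
  move=> /finset.set0Pn[i si]; rewrite /pk; case: pickP => //= /(_ i).
  by rewrite si.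
pose w (x : 'rV[R]_n) i := \sum_(s : {set 'I_n} | pk s == i) level th s x.
have w_ge0 (x : 'rV[R]_n) i : (forall j, 0 <= x ord0 j) -> 0 <= w x i.
  by move=> x0; apply: sumr_ge0 => s _; exact: level_ge0.
have w_pos (x : 'rV[R]_n) s : (forall j, 0 <= x ord0 j) -> 0 < level th s x -> 0 < w x (pk s).
  move=> x0 ls; rewrite /w (bigD1 s) //= ltr_pwDl //.
  by apply: sumr_ge0 => t _; exact: level_ge0.
have ex_level (x : 'rV[R]_n) : (forall j, 0 <= x ord0 j) -> \sum_i x ord0 i = 1 ->
    exists s, 0 < level th s x.
  move=> x0 x1; have [i xi] := exists_coord_ge x1.
  exists [set j | th <= x ord0 j]%SET; apply: (level_top (i := i)) => //.
  exact: le_trans (ltW thn) xi.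
apply: (homotopic_skel_cst (u := fun x => barycentre (w x))) => [x []//||].
  apply: cont_on_barycentre => [x i [[x0 _ _] _]|x [[x0 x1 _] _]|i].
  - exact: w_ge0.
  - by have [s ls] := ex_level x x0 x1; exists (pk s); exact: w_pos.
  - by apply: cont_on_sum => s _; exact: cont_on_level.
move=> x [[x0 x1 xX] /= mx].
pose L := [set s | 0 < level th s x]%SET.
exists (pk @: L)%SET; split.
- apply: in_simplex_barycentre => [i||i iL].
  + exact: w_ge0.
  + by have [s ls] := ex_level x x0 x1; exists (pk s); exact: w_pos.
  + rewrite /w big1 // => s /eqP si; apply/eqP; apply: contraNT iL => ls.
    apply/finset.imsetP; exists s => //; rewrite finset.inE lt_def ls.
    exact: level_ge0.
- apply/fintype.subsetP => _ /finset.imsetP[s + ->]; rewrite finset.inE => ls.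
  have [s0 _ _] := (level_gt0P th s x0).1 ls.
  exact: (fintype.subsetP (level_supp x0 ls)) (pkP s s0).
- apply: leq_trans (leq_imset_card _ _) _; apply: chain_card_le.
    by move=> s t; rewrite !finset.inE; exact: level_chain.
  move=> s; rewrite finset.inE => ls.
  have [s0 _ _] := (level_gt0P th s x0).1 ls.
  rewrite dimX ?andbT; last first.
    exact: (subcomplex_sub cX xX s0 (level_supp x0 ls)).
  (* The more than [m] coordinates above [th] lie in every active level set, whence the lower bound
     on its size. *)
  have [S mS pS] : exists2 S : {set 'I_n}, (m < #|S|)%N &
      0 < \prod_(i in S) excess th x i.
    apply: contrapT => nS; move: mx; rewrite /many_large big1 ?ltxx // => S mS.
    apply/le_anti; rewrite prodr_ge0 ?andbT => [|i _]; last exact: excess_ge0.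
    by rewrite leNgt; apply/negP => pS; apply: nS; exists S.
  apply: leq_trans mS _; apply: subset_leq_card; apply/fintype.subsetP => i iS.
  apply: (level_mem x0 ls); rewrite leNgt; apply/negP => xi.
  by move: pS; rewrite (bigD1 i) //= excess_eq0 ?mul0r ?ltxx // ltW.
Qed.

Lemma two_contractible_opens : exists (p : 'rV[R]_n) (g : bool -> 'rV[R]_n -> R),
  [/\ forall b, continuous (g b),
      forall x, 0 < g true x \/ 0 < g false x, rX p &
      forall b, homotopic R (rX `&` [set x | 0 < g b x]) rX id (fun=> p)].
Proof.
have [p pX np] := skel_null.
have [xX _] := realization_supp pX.
have /finset.set0Pn[i0 _] := subcomplex_neq0 cX xX.
have n0 : (0 < n)%N by apply: leq_ltn_trans (ltn_ord i0).
pose th : R := n.+1%:R^-1; pose th' : R := n.+2%:R^-1.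
have th0 : 0 < th by rewrite invr_gt0 ltr0n.
have th'0 : 0 < th' by rewrite invr_gt0 ltr0n.
have tht : th' < th by rewrite ltf_pV2 ?posrE ?ltr0n // ltr_nat.
have thn : th < n%:R^-1 by rewrite ltf_pV2 ?posrE ?ltr0n // ltr_nat.
exists p, (fun b => if b then few_large th else many_large th'); split=> //.
- case; apply: cont_on_continuous.
    exact: cont_on_few_large.
  exact: cont_on_many_large.
- by move=> x; exact: few_or_many_large.
- case; first exact: few_large_homotopic.
  by apply: many_large_homotopic => //; exact: lt_trans thn.
Qed.

End two_contractible_opens.

(** * From contractible open sets to motion planners *)

Section sections_of_endpoints.
Variables (R : realType) (V : topologicalType) (C : set V).
Let Y : topologicalType := set_type C.
Let v (y : Y) : V := set_val y.

(** A homotopy over [U] between the two projections is, after currying its time variable, a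
    continuous choice of paths. *)
Lemma has_section_homotopic (U : set (Y * Y)) :
  homotopic R U C (fun p => v p.1) (fun p => v p.2) -> has_section R U.
Proof.
move=> [H [cH HC HE]].
(* Outside [U] the value is a constant path; continuity there is automatic because such points are
   isolated in [subspace U]. *)
pose G (pt : Y * Y * unit_interval R) : Y :=
  if pselect (U pt.1) then insubd pt.1.1 (H (pt.1, set_val pt.2)) else pt.1.1.
have I01 (t : unit_interval R) : 0 <= set_val t <= 1.
  by have := set_valP t; rewrite /= in_itv.
have GU p t : U p -> v (G (p, t)) = H (p, set_val t).
  move=> Up; rewrite /G /=; case: pselect => [Up'|] //=.
  by rewrite /v set_valE insubdK //; apply/mem_set; exact: HC.
have GnU p t : ~ U p -> G (p, t) = p.1.
  by move=> nUp; rewrite /G /=; case: pselect.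
have cG : continuous (G : subspace U * unit_interval R -> Y).
  apply: continuous_comp_initial => -[p t] P /= nP.
  have [Up|nUp] := pselect (U p); last first.
    exists ([set p], setT); first split=> /=.
    - by rewrite /nbhs /= -nbhs_subspace_out.
    - exact: filterT.
    - move=> [q u] [/= -> _]; rewrite /= GnU //.
      by move: nP => /nbhs_singleton; rewrite /= GnU.
  have Ct : cylinder U (p, set_val t) by split=> //=; exact: I01.
  have nPH : nbhs (H (p, set_val t)) P by rewrite -GU.
  have [[A B] [/= nA nB] AB] := cH (p, set_val t) Ct P nPH.
  exists ([set q | U q -> A q] `&` U, set_val @^-1` B); first split=> /=.
  - rewrite /nbhs /= -nbhs_subspace_in //; apply: filterS nA => q Aq Uq.
    by split.
  - exact: initial_continuous.
  - move=> [q u] [/= [Aq Uq] Bu].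
    have := AB (q, set_val u) (conj (Aq Uq) Bu) (conj Uq (I01 u)).
    by rewrite -GU.
have cGp p : continuous (fun t : unit_interval R => G (p, t)).
  exact: (continuous_curry cG).2.
pose s (p : Y * Y) : path_space R Y := mkcts (cGp p).
exists s; split.
  have := continuous_curry_fun cG.
  move=> cc; apply: continuous_comp_initial; exact: cc.
move=> [a b] /set_mem Up; have [h0 h1] := HE (a, b) Up.
congr pair; apply: val_inj.
  exact: etrans (GU (a, b) (unit0 R) Up) h0.
exact: etrans (GU (a, b) (unit1 R) Up) h1.
Qed.

End sections_of_endpoints.

Section TC_from_two_opens.
Variables (R : realType) (V : topologicalType) (C : set V).
Variables (p : V) (g : bool -> V -> R).
Hypothesis cg : forall b, continuous (g b).
Hypothesis gpos : forall x, 0 < g true x \/ 0 < g false x.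
Hypothesis Cp : C p.
Hypothesis gnull :
  forall b, homotopic R (C `&` [set x | 0 < g b x]) C id (fun=> p).
Let Y : topologicalType := set_type C.

Let U (b c : bool) : set (Y * Y) :=
  [set y | 0 < g b (set_val y.1) /\ 0 < g c (set_val y.2)].

(** The planner follows the contraction of the first end point to [p], then the contraction of the
    second one backwards. *)
Let sectionU b c : has_section R (U b c).
Proof.
apply: has_section_homotopic.
have c1 A : cont_on A (fun y : Y * Y => set_val y.1 : V).
  apply: continuous_cont_on => y.
  apply: (@continuous_comp _ _ _ fst set_val); first exact: cvg_fst.
  exact: initial_continuous.
have c2 A : cont_on A (fun y : Y * Y => set_val y.2 : V).
  apply: continuous_cont_on => y.
  apply: (@continuous_comp _ _ _ snd set_val); first exact: cvg_snd.
  exact: initial_continuous.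
apply: (@homotopic_trans _ _ _ _ _ _ (fun=> p)).
  apply: homotopic_comp (c1 _) _ (gnull b) => y [y1 y2]; split=> //.
  exact: set_valP.
apply: homotopic_sym.
apply: homotopic_comp (c2 _) _ (gnull c) => y [y1 y2]; split=> //.
exact: set_valP.
Qed.

Let coverU (y : Y * Y) : exists b c, U b c y.
Proof.
by have [h1|h1] := gpos (set_val y.1); have [h2|h2] := gpos (set_val y.2);
  do 2![eexists]; split; eauto.
Qed.

Let openU b c : open (U b c).
Proof.
have pos_open (h : Y * Y -> V) d : continuous h ->
    open [set y | 0 < g d (h y)].
  move=> ch; apply: (@open_comp _ _ (g d \o h) [set r | 0 < r]).
    by move=> y _; apply: continuous_comp; [exact: ch|exact: cg].
  exact: open_gt.
apply: openI.
  apply: (pos_open (fun y => set_val y.1)) => y.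
  apply: (@continuous_comp _ _ _ fst set_val); first exact: cvg_fst.
  exact: initial_continuous.
apply: (pos_open (fun y => set_val y.2)) => y.
apply: (@continuous_comp _ _ _ snd set_val); first exact: cvg_snd.
exact: initial_continuous.
Qed.

Lemma section_cover_two_opens : section_cover R Y 3.
Proof.
(* The two binary digits of [i] encode the pair of booleans. *)
exists (fun i : 'I_4 => U (odd i) (2 <= i)%N); split=> [i||i].
- exact: openU.
- apply/seteqP; split=> // y _; have [b [c bc]] := coverU y.
  have ilt : (b + 2 * c < 4)%N by case: b {bc}; case: c.
  by exists (Ordinal ilt) => //=; move: bc; case: b ilt; case: c.
- exact: sectionU.
Qed.

Lemma path_connected_two_opens : path_connected R Y.
Proof.
split; first by apply: inhabits; exact: (exist _ p (mem_set Cp)).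
move=> y; have [b [c bc]] := coverU y; have [s [_ sK]] := sectionU b c.
by exists (s y); apply: sK; exact: mem_set.
Qed.

End TC_from_two_opens.

Lemma TC_le_section_cover (R : realType) (Y : topologicalType) k m :
  path_connected R Y -> section_cover R Y k -> (k <= m)%N -> TC_le R Y m.
Proof.
move=> pY cY km; split=> //.
have [|j /asboolP cj jmin] := @ex_minnP (fun j => `[< section_cover R Y j >]).
  by exists k; apply/asboolP.
exists j; first by split=> // i /asboolP; exact: jmin.
by apply: leq_trans km; apply: jmin; exact/asboolP.
Qed.

Lemma TC_le_coning (R : realType) n (X : {set {set 'I_n}}) F m :
  subcomplex X -> coning X F -> (3 ^ m <= F)%N ->
  (forall s, s \in X -> (#|s| <= 2 * m)%N) -> TC_le R (realization R n X) 4.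
Proof.
move=> cX coneX mF dX.
have [p [g [cg gpos Xp gnull]]] := two_contractible_opens R cX coneX mF dX.
apply: (@TC_le_section_cover _ _ 3) => //.
  exact: path_connected_two_opens gpos Xp gnull.
exact: section_cover_two_opens cg gpos gnull.
Qed.

(** * The medial measure as a product measure *)

Section random_sets.
Variable T : finType.
Implicit Types (A B C w : {set T}).

Lemma card_set_type : #|{set T}| = (2 ^ #|T|)%N.
Proof.
rewrite -(cardsT T) -card_powerset; apply: eq_card => w.
by rewrite finset.powersetE finset.subsetT.
Qed.

Lemma card_set_between A C : A \subset C ->
  #|[set w : {set T} | (A \subset w) && (w \subset C)]%SET| = (2 ^ #|C :\: A|%SET)%N.
Proof.
move=> AC; rewrite -card_powerset.
have injU : {in powerset (C :\: A)%SET &, injective (fun w => A :|: w)%SET}.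
  move=> u u'; rewrite !finset.powersetE => /fintype.subsetP uC /fintype.subsetP uC'.
  move=> /finset.setP uu; apply/finset.setP => x; have := uu x; rewrite !finset.inE.
  have [xA _|//] := boolP (x \in A).
  by apply/idP/idP => [/uC|/uC']; rewrite finset.inE xA.
rewrite -(card_in_imset injU).
apply: eq_card => w; rewrite finset.inE; apply/andP/finset.imsetP.
  move=> [Aw wC]; exists (w :\: A)%SET.
    by rewrite finset.powersetE finset.setSD.
  rewrite finset.setDE finset.setUIr finset.setUCr finset.setIT.
  exact/esym/finset.setUidPr.
move=> [u]; rewrite finset.powersetE finset.subsetD => /andP[uC _] ->.
by rewrite finset.subsetUl finset.subUset AC.
Qed.

(** Independence in counting form: for uniform [w] and disjoint sets [B i] of size at most [q], no
    [B i] is contained in [w] with probability at most [(1 - 2 ^ -q) ^ size r]. *)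
Lemma card_avoiding (I : eqType) (r : seq I) (B : I -> {set T}) q : uniq r ->
  {in r, forall i, #|B i| <= q}%N ->
  {in r &, forall i j, i != j -> (B i :&: B j)%SET = finset.set0} ->
  (#|[set w : {set T} | all (fun i => ~~ (B i \subset w)) r]%SET| * 2 ^ (q * size r)
   <= 2 ^ #|T| * (2 ^ q).-1 ^ size r)%N.
Proof.
elim: r => [|i r IH] /=.
  move=> _ _ _; rewrite muln0 !expn0 !muln1 -cardsT.
  by rewrite cardsT -card_set_type; exact: max_card.
move=> /andP[ir ur] Bq dB.
have mr j : j \in r -> j \in i :: r by rewrite in_cons orbC => ->.
have {IH} := IH ur (fun j jr => Bq j (mr _ jr))
  (fun j k jr kr => dB j k (mr _ jr) (mr _ kr)).
set G' := [set w | _]%SET; set G := [set w | _]%SET.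
pose Hs := [set w in G' | B i \subset w]%SET.
have cG : (#|G| + #|Hs| = #|G'|)%N.
  rewrite -(cardsID [set w : {set T} | B i \subset w]%SET G') addnC; congr (_ + _)%N.
    by apply: eq_card => w; rewrite !finset.inE.
  by apply: eq_card => w; rewrite !finset.inE.
(* Given that the other sets are avoided, [B i] is contained in [w] with probability at least
   [2 ^ -q]: adding [B i] to [w] keeps the other, disjoint sets avoided, and [w] is recovered from
   its trace on [B i]. *)
have cH : (#|G'| <= #|Hs| * 2 ^ q)%N.
  apply: (@leq_trans (#|Hs| * 2 ^ #|B i|)); last first.
    by rewrite leq_mul2l leq_exp2l // Bq ?orbT // mem_head.
  rewrite -card_powerset -cardsX.
  pose f w := ((w :|: B i)%SET, (w :&: B i)%SET).
  suff injf : {in G' &, injective f}.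
    rewrite -(card_in_imset injf).
    apply: subset_leq_card; apply/fintype.subsetP => _ /finset.imsetP[w + ->].
    rewrite !finset.inE /= finset.subsetIr finset.subsetUr !andbT.
    move=> /allP wG; apply/allP => j jr; apply: contra (wG j jr) => jw.
    have ij : j != i by apply: contraNneq ir => <-.
    have dj := dB j i (mr _ jr) (mem_head _ _) ij.
    apply/fintype.subsetP => x xj.
    have := fintype.subsetP jw x xj; rewrite finset.inE => /orP[//|xi].
    have : x \in (B j :&: B i)%SET by rewrite finset.inE xj.
    by rewrite dj finset.inE.
  move=> w w' _ _ [wU wI]; apply/finset.setP => x.
  have := congr1 (fun A => x \in A) wU; have := congr1 (fun A => x \in A) wI.
  by rewrite !finset.inE; case: (x \in B i); rewrite ?andbT ?andbF ?orbF.
move=> IH.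
have step : (#|G| * 2 ^ q <= #|G'| * (2 ^ q).-1)%N.
  have q0 : (0 < 2 ^ q)%N by rewrite expn_gt0.
  have -> : #|G| = (#|G'| - #|Hs|)%N by rewrite -cG addnK.
  rewrite mulnBl -[X in (_ <= _ * X)%N]subn1 mulnBr muln1.
  by rewrite leq_sub2l.
rewrite mulnS expnD expnS.
apply: (@leq_trans (#|G'| * (2 ^ q).-1 * 2 ^ (q * size r))).
  by rewrite mulnA leq_mul2r step orbT.
by rewrite mulnAC [((2 ^ q).-1 * _)%N]mulnC mulnA leq_mul2r IH orbT.
Qed.

End random_sets.

Section medial.
Variable n : nat.
Implicit Types (X K w : {set {set 'I_n}}) (r s t : {set 'I_n}).

Definition complex_of w : {set {set 'I_n}} :=
  [set s : {set 'I_n} | (s != finset.set0) && [forall t : {set 'I_n},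
     (t != finset.set0) && (t \subset s) ==> (t \in w)]]%SET.

Lemma complex_ofP w s : reflect (s != finset.set0 /\
    forall t, t != finset.set0 -> t \subset s -> t \in w) (s \in complex_of w).
Proof.
rewrite finset.inE; apply: (iffP andP) => -[s0 h]; split=> //.
  by move=> t t0 ts; have /forallP/(_ t) := h; rewrite t0 ts.
by apply/forallP => t; apply/implyP => /andP[]; exact: h.
Qed.

Lemma subcomplex_complex_of w : subcomplex (complex_of w).
Proof.
apply/andP; split; first by rewrite finset.inE eqxx.
apply/subcomplexP => s t /complex_ofP[_ h] t0 ts; apply/complex_ofP; split=> //.
by move=> u u0 ut; apply: h => //; exact: fintype.subset_trans ts.
Qed.

Lemma externalP X s : reflect [/\ s != finset.set0, s \notin X &
    forall t, t != finset.set0 -> t \proper s -> t \in X] (s \in external X).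
Proof.
rewrite finset.inE; apply: (iffP and3P) => -[s0 sX h]; split=> //.
  by move=> t t0 ts; have /forallP/(_ t) := h; rewrite t0 ts.
by apply/forallP => t; apply/implyP => /andP[]; exact: h.
Qed.

(** The membership in [w] is prescribed on the faces of [X] and on its external simplexes, and free
    elsewhere; this is where the exponent [medialH X] comes from. *)
Lemma complex_of_eq X w : subcomplex X ->
  (complex_of w == X) = (X \subset w) && (w \subset ~: external X)%SET.
Proof.
move=> cX; apply/eqP/andP => [<-|[Xw wE]].
  split; apply/fintype.subsetP => s; first by case/complex_ofP => s0; apply.
  move=> sw; rewrite finset.inE; apply/externalP => -[s0 /negP sX h]; apply: sX.
  apply/complex_ofP; split=> // t t0; rewrite finset.subEproper => /orP[/eqP -> //|].
  by move=> /(h t t0)/complex_ofP[_]; apply.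
apply/finset.setP => s; apply/idP/idP => [|sX]; last first.
  apply/complex_ofP; split; first exact: subcomplex_neq0 sX.
  by move=> t t0 ts; apply: (fintype.subsetP Xw); exact: subcomplex_sub ts.
(* By induction on the size, the proper faces of [s] are in [X]; were [s] not in [X], it would be
   external and hence outside [w]. *)
have [k] := ubnP #|s|; elim: k s => // k IH s sk /complex_ofP[s0 h].
apply: contraT => sX; have : s \in w by exact: h s s0 (fintype.subxx _).
move=> /(fintype.subsetP wE); rewrite finset.inE => /externalP[]; split=> //.
move=> t t0 ts; apply: IH; first exact: leq_trans (proper_card ts) _.
apply/complex_ofP; split=> // u u0 ut; apply: h => //.
exact: fintype.subset_trans ut (proper_sub ts).
Qed.

Lemma card_complex_of X : subcomplex X ->
  (#|[set w | complex_of w == X]%SET| * 2 ^ medialH X = 2 ^ (2 ^ n))%N.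
Proof.
move=> cX.
have XE : X \subset (~: external X)%SET.
  apply/fintype.subsetP => s sX; rewrite finset.inE; apply/externalP.
  by move=> [_ /negP sX' _]; exact: sX'.
have -> : [set w | complex_of w == X]%SET =
    [set w : {set {set 'I_n}} | (X \subset w) && (w \subset ~: external X)%SET]%SET.
  by apply/finset.setP => w; rewrite !finset.inE complex_of_eq.
rewrite card_set_between // -expnD; congr (2 ^ _)%N.
have c1 := cardsD (~: external X)%SET X; have c2 := cardsC (external X).
have c3 := subset_leq_card XE.
have <- : #|{set 'I_n}| = (2 ^ n)%N by rewrite card_set_type card_ord.
move: c1; rewrite (finset.setIidPr XE) => c1.
by rewrite /medialH -c2 c1 addnA subnK // addnC.
Qed.

Variable R : realType.

(** The sets [w] are grouped by the complex they generate. They are sets of arbitrary subsets, the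
    empty one included, hence the total [2 ^ (2 ^ n)]. *)
Lemma medial_probE (A : set {set {set 'I_n}}) :
  medial_prob R A = #|[set w | `[< A (complex_of w) >]]%SET|%:R / 2 ^+ (2 ^ n).
Proof.
set S := [set w | _]%SET.
have -> : #|S| = (\sum_(X : {set {set 'I_n}} | subcomplex X && `[< A X >])
    #|[set w | complex_of w == X]%SET|)%N.
  rewrite -sum1_card.
  rewrite (partition_big complex_of (fun X => subcomplex X && `[< A X >])) /=.
    apply: eq_bigr => X /andP[cX AX]; rewrite -sum1_card; apply: eq_bigl => w.
    by rewrite !finset.inE; case: eqP => [->|]; rewrite ?andbF // AX.
  by move=> w; rewrite finset.inE => ->; rewrite subcomplex_complex_of.
rewrite natr_sum mulr_suml; apply: eq_bigr => X /andP[cX AX].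
apply: (canRL (mulfK _)); first by rewrite expf_neq0 // pnatr_eq0.
by rewrite -[2 ^+ (2 ^ n)]natrX -(card_complex_of cX) natrM natrX mulrC mulfK.
Qed.

Lemma medial_probC (A : set {set {set 'I_n}}) :
  1 - medial_prob R A = medial_prob R (~` A).
Proof.
rewrite !medial_probE; apply/eqP; rewrite subr_eq addrC -mulrDl -natrD.
set S := [set w | _]%SET; have -> : [set w | `[< (~` A) (complex_of w) >]]%SET = (~: S)%SET.
  apply/finset.setP => w; rewrite !finset.inE.
  by apply/asboolP/negP => [nA /asboolP|h /asboolP].
by rewrite cardsC card_set_type card_set_type card_ord natrX divff.
Qed.

End medial.

(** * Exceptional events *)

Lemma union_bound (W I : finType) (Q : pred W) (J : {set I})
    (E : I -> {set W}) c d :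
  (forall w, Q w -> exists2 i, i \in J & w \in E i) ->
  (forall i, i \in J -> #|E i| * d <= c)%N ->
  (#|[set w | Q w]%SET| * d <= #|J| * c)%N.
Proof.
move=> QE Ec; apply: (@leq_trans ((\sum_(i in J) #|E i|) * d)); last first.
  by rewrite big_distrl /= -sum_nat_const; apply: leq_sum => i /Ec.
rewrite leq_mul2r; apply/orP; right; rewrite -sum1_card.
under [X in (_ <= X)%N]eq_bigr do rewrite -sum1_card big_mkcond /=.
rewrite exchange_big big_mkcond /=; apply: leq_sum => w _; rewrite finset.inE.
case: ifP => // /QE[i iJ wE]; rewrite (bigD1 i) //= wE; exact: leq_addr.
Qed.

Lemma card_small_sets (T : finType) k :
  (#|[set s : {set T} | (#|s| <= k)%N]%SET| <= #|T|.+1 ^ k)%N.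
Proof.
(* A set of at most [k] elements is listed in [k] places, padded with [None]. *)
pose f (g : {ffun 'I_k -> option T}) : {set T} := [set x | Some x \in codom g]%SET.
rewrite -card_option -[X in (_ ^ X)%N](card_ord k) -card_ffun -cardsT.
apply: leq_trans (leq_imset_card f _); apply: subset_leq_card.
apply/fintype.subsetP => s; rewrite finset.inE => sk; apply/finset.imsetP.
exists [ffun i : 'I_k => nth None (map Some (enum s)) i]; first by rewrite finset.inE.
apply/finset.setP => x; rewrite finset.inE; apply/idP/codomP => [xs|[i]].
  have xi : (index x (enum s) < #|s|)%N by rewrite cardE index_mem mem_enum.
  exists (Ordinal (leq_trans xi sk)); rewrite ffunE /=.
  by rewrite (nth_map x) -?cardE // nth_index // mem_enum.
rewrite ffunE; have [il|li] := ltnP i (size (enum s)).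
  by rewrite (nth_map x) // => -[->]; rewrite -mem_enum mem_nth.
by rewrite nth_default // size_map.
Qed.

Section bad_events.
Variable n : nat.
Implicit Types (X K w : {set {set 'I_n}}) (r s t : {set 'I_n}).

(** A given face of [k] vertices appears only if its [2 ^ k - 1] nonempty subsets are all in [w]. *)
Lemma card_large_face k :
  (#|[set w : {set {set 'I_n}} | [exists s in complex_of w, #|s| == k]]%SET| * 2 ^ (2 ^ k).-1
   <= n.+1 ^ k * 2 ^ (2 ^ n))%N.
Proof.
pose J : {set {set 'I_n}} := [set s : {set 'I_n} | #|s| == k]%SET.
apply: (@leq_trans (#|J| * 2 ^ (2 ^ n))); last first.
  rewrite leq_mul2r; apply/orP; right.
  rewrite -[X in (X.+1 ^ _)%N](card_ord n); apply: leq_trans (card_small_sets _ _).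
  by apply: subset_leq_card; apply/fintype.subsetP => s; rewrite !finset.inE => /eqP ->.
pose A s := (powerset s :\ finset.set0)%SET.
apply: (union_bound (E := fun s => [set w : {set {set 'I_n}} |
   (A s \subset w) && (w \subset [set: {set 'I_n}])]%SET)) => [w|s].
  case/exists_inP => s /complex_ofP[s0 h] sk; exists s; first by rewrite finset.inE.
  rewrite finset.inE finset.subsetT andbT; apply/fintype.subsetP => t.
  by rewrite !finset.inE => /andP[t0 ts]; exact: h.
rewrite finset.inE => /eqP sk; rewrite card_set_between ?finset.subsetT //.
rewrite -expnD leq_exp2l // finset.setTD.
have cA : #|A s| = (2 ^ k).-1.
  have := cardsD1 finset.set0 (powerset s).
  by rewrite card_powerset sk finset.powersetE finset.sub0set => ->.
by rewrite -cA addnC cardsC card_set_type card_ord.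
Qed.

(** A face of [r :|: [set v]] either contains [v], and is then in [w] by hypothesis, or is a face of
    [K]. *)
Lemma link_cone w K v : face_family (complex_of w) K -> v \notin finset.cover K ->
  ([set (r :|: [set v]) | r in K] \subset w)%SET ->
  [set v]%SET \in link (complex_of w) K.
Proof.
move=> [K0 Kd KX] vK /fintype.subsetP Bw.
have vr r : r \in K -> v \notin r.
  move=> rK; apply: contra vK => vr; apply/finset.bigcupP; by exists r.
apply/linkP; split; first by apply/finset.set0Pn; exists v; rewrite finset.inE.
move=> r rK; split; last first.
  apply/finset.setP => x; rewrite !finset.inE; apply/negP => /andP[xr /eqP xv].
  by move: (vr r rK); rewrite -xv xr.
apply/complex_ofP; split.
  by apply/finset.set0Pn; exists v; rewrite !finset.inE eqxx orbT.
move=> t t0 trv; have [vt|vt] := boolP (v \in t).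
  apply: Bw; apply/finset.imsetP; exists (t :\ v)%SET; last first.
    by rewrite finset.setUC finset.setD1K.
  by apply: (Kd r) => //; rewrite finset.subDset finset.setUC.
have tr : t \subset r.
  apply/fintype.subsetP => x xt; have := fintype.subsetP trv x xt.
  by rewrite !finset.inE => /orP[//|/eqP xv]; move: vt; rewrite -xv xt.
have /complex_ofP[_] := KX t (Kd r t rK tr) t0; exact.
Qed.

Lemma card_cover_face_family X K : face_family X K -> (#|finset.cover K| <= #|K|)%N.
Proof.
move=> [_ Kd _]; rewrite -(card_imset _ finset.set1_inj).
apply: subset_leq_card; apply/fintype.subsetP => _ /finset.imsetP[i + ->].
by move=> /finset.bigcupP[r rK ir]; apply: (Kd r) => //; rewrite finset.sub1set.
Qed.

(** The families [K] are counted by their vertex set and then as sets of its subsets. For a fixed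
    [K], different vertices outside it need disjoint sets of simplexes in order to cone it off, so
    [card_avoiding] applies. *)
Lemma card_not_coning F : (F <= n)%N ->
  (#|[set w : {set {set 'I_n}} | ~~ `[< coning (complex_of w) F >]]%SET| * 2 ^ (F * (n - F)) <=
   n.+1 ^ F * 2 ^ (2 ^ F) * (2 ^ (2 ^ n) * (2 ^ F).-1 ^ (n - F)))%N.
Proof.
move=> Fn; pose J := [set K : {set {set 'I_n}} | (#|finset.cover K| <= F)%N && (#|K| <= F)%N]%SET.
pose B K v : {set {set 'I_n}} := [set (r :|: [set v]) | r in K]%SET.
(* Exactly [n - F] outer vertices are kept, to have the same exponent for every [K]. *)
pose rest K := take (n - F) (enum (~: finset.cover K)%SET).
apply: (@leq_trans (#|J| * (2 ^ (2 ^ n) * (2 ^ F).-1 ^ (n - F)))); last first.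
  rewrite leq_mul2r; apply/orP; right; rewrite -[#|J|]muln1.
  apply: leq_trans (union_bound (J := [set s : {set 'I_n} | (#|s| <= F)%N]%SET)
    (E := fun s => powerset (powerset s)) (c := 2 ^ (2 ^ F)) _ _) _.
  - move=> K /andP[KF _]; exists (finset.cover K); first by rewrite finset.inE.
    rewrite finset.powersetE; apply/fintype.subsetP => r rK.
    by rewrite finset.powersetE; exact: finset.bigcup_sup.
  - move=> s; rewrite finset.inE => sF.
    by rewrite muln1 !card_powerset !leq_exp2l.
  - rewrite leq_mul2r; apply/orP; right.
    by rewrite -[X in (X.+1 ^ _)%N](card_ord n); exact: card_small_sets.
apply: (union_bound (E := fun K => [set w : {set {set 'I_n}} |
   all (fun v => ~~ (B K v \subset w)) (rest K)]%SET)) => [w|K].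
  move=> /asboolPn nc; have [K [KK KF nv]] : exists K, [/\
      face_family (complex_of w) K, (#|K| <= F)%N &
      forall v, [set v]%SET \notin link (complex_of w) K].
    apply: contrapT => h; apply: nc => K KK KF; apply: contrapT => nv; apply: h.
    by exists K; split=> // v; apply/negP => vK; apply: nv; exists v.
  exists K; first by rewrite finset.inE KF (leq_trans (card_cover_face_family KK)).
  rewrite finset.inE; apply/allP => v /mem_take; rewrite mem_enum finset.inE => vK.
  by apply: contra (nv v); exact: link_cone.
rewrite finset.inE => /andP[cK KF].
have vr r v : v \in rest K -> r \in K -> v \notin r.
  move=> /mem_take; rewrite mem_enum finset.inE => vK rK.
  by apply: contra vK => vr; apply/finset.bigcupP; exists r.
have sr : size (rest K) = (n - F)%N.
  rewrite size_takel // -cardE; have := cardsC (finset.cover K); rewrite card_ord; lia.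
have := card_avoiding (r := rest K) (B := B K) (q := F).
rewrite sr card_set_type card_ord; apply.
- by rewrite take_uniq // enum_uniq.
- by move=> v _; apply: leq_trans (leq_imset_card _ _) KF.
- move=> u v uK vK uv; apply/finset.setP => x; rewrite finset.inE finset.in_set0.
  apply/negP => /andP[/finset.imsetP[r rK ->] /finset.imsetP[t tK rt]].
  have : u \in (t :|: [set v])%SET by rewrite -rt !finset.inE eqxx orbT.
  by rewrite !finset.inE (negbTE uv) orbF (negbTE (vr _ _ uK tK)).
Qed.

End bad_events.

(** * Asymptotics *)

(** Bernoulli's inequality for [(1 + 1 / k) ^ e.+1], cleared of denominators. *)
Lemma bernoulli_nat k e : (k ^ e.+1 + e.+1 * k ^ e <= k.+1 ^ e.+1)%N.
Proof.
elim: e => [|e IH]; first by rewrite !expn1 expn0 muln1 addn1.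
have : (k.+1 * (k ^ e.+1 + e.+1 * k ^ e) <= k.+1 * k.+1 ^ e.+1)%N.
  by rewrite leq_mul2l IH orbT.
rewrite -expnS; apply: leq_trans.
by rewrite [(k ^ e.+2)%N]expnS ![(k ^ e.+1)%N]expnS; nia.
Qed.

(** This is [(1 - 1 / q) ^ q <= 1 / 2] raised to the power [j]. *)
Lemma pred_exp_le q j : (0 < q)%N ->
  (q.-1 ^ (q * j) * 2 ^ j <= q ^ (q * j))%N.
Proof.
case: q => // k _; rewrite !expnM -expnMn.
case: j => // j; rewrite leq_exp2r //; apply: leq_trans (bernoulli_nat k k).
by rewrite /= expnS; nia.
Qed.

Lemma pred_exp_le_div q D : (0 < q)%N ->
  (q.-1 ^ D * 2 ^ (D %/ q) <= q ^ D)%N.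
Proof.
move=> q0; rewrite {1 3}(divn_eq D q) !expnD mulnAC.
rewrite [(D %/ q * q)%N]mulnC; apply: leq_mul; first exact: pred_exp_le.
by case: (D %% q)%N => // e; rewrite leq_exp2r // leq_pred.
Qed.

Lemma sqr_le_exp2 k : (4 <= k -> k ^ 2 <= 2 ^ k)%N.
Proof.
elim: k => // k IH; rewrite leq_eqVlt => /orP[/eqP [<-] //|k4].
by have := IH k4; rewrite [(2 ^ k.+1)%N]expnS; nia.
Qed.

Lemma exp3_exp4 m : (20 <= m -> 12 * 3 ^ m * (2 * m).+1 + m < 2 * 4 ^ m)%N.
Proof.
elim: m => // m IH; rewrite leq_eqVlt => /orP[/eqP [<-]|m20]; first lia.
have := IH m20; rewrite [(3 ^ m.+1)%N]expnS [(4 ^ m.+1)%N]expnS.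
have : (0 < 3 ^ m)%N by rewrite expn_gt0.
by nia.
Qed.

(* With [l = log2 n] and [F = 3 ^ m] for this [m], [4 F <= l < 12 F]: then
   [2 ^ F <= n ^ (1/4)] lets small subcomplexes be coned off, and [4 ^ m], which
   outgrows [l * m], rules out faces of [2 m + 1] vertices. *)
Definition conn_rank (n : nat) : nat := trunc_log 3 (trunc_log 2 n %/ 4).

Section asymptotics.
Variable n : nat.
Let m := conn_rank n.
Let F := (3 ^ m)%N.
Hypothesis m20 : (20 <= m)%N.

Let l_ge : (4 * F <= trunc_log 2 n)%N.
Proof.
have l0 : (0 < trunc_log 2 n %/ 4)%N.
  by rewrite lt0n; apply: contraTneq m20 => l0; rewrite /m /conn_rank l0 trunc_log0.
have : (F <= trunc_log 2 n %/ 4)%N by exact: trunc_logP.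
lia.
Qed.

Let l_lt : ((trunc_log 2 n).+1 <= 12 * F)%N.
Proof.
have : (trunc_log 2 n %/ 4 < 3 ^ m.+1)%N by exact: trunc_log_ltn.
by rewrite expnS -/F; lia.
Qed.

Let n_ge : (2 ^ (4 * F) <= n)%N.
Proof.
have n0 : (0 < n)%N.
  rewrite lt0n; apply: contraTneq m20 => n0.
  by rewrite /m /conn_rank n0 trunc_log0 div0n trunc_log0.
apply: leq_trans (trunc_logP (p := 2) _ n0) => //.
by rewrite leq_exp2l.
Qed.

Let n_lt : (n < 2 ^ (12 * F))%N.
Proof.
apply: leq_trans (trunc_log_ltn n (isT : 1 < 2)%N) _.
by rewrite leq_exp2l.
Qed.

Let m_lt_F : (m < F)%N.
Proof. exact: ltn_expl. Qed.

(** As [n < 2 ^ (12 F)], the exponent on the left is at most [12 F (2 m + 1) + m], which [exp3_exp4]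
    puts below [2 ^ (2 m + 1)]. The factor [2 ^ m] is the rate of decay kept for the limit. *)
Lemma large_face_bound :
  (n.+1 ^ (2 * m).+1 * 2 ^ m <= 2 ^ (2 ^ (2 * m).+1).-1)%N.
Proof.
have e4 := exp3_exp4 m20; rewrite -/F in e4.
apply: (@leq_trans ((2 ^ (12 * F)) ^ (2 * m).+1 * 2 ^ m)).
  by rewrite leq_mul2r leq_exp2r // n_lt orbT.
rewrite -expnM -expnD leq_exp2l // [(2 ^ (2 * m).+1)%N]expnS expnM.
rewrite (_ : (2 ^ 2 = 4)%N) //; lia.
Qed.

Lemma leq_F_n : (F <= n)%N.
Proof.
apply: leq_trans n_ge; apply: leq_trans (ltnW (ltn_expl F (isT : 1 < 2)%N)) _.
by rewrite leq_exp2l //; lia.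
Qed.

(** With [q = 2 ^ F] one has [q ^ 4 <= n], so [(1 - 1 / q) ^ (n - F)] gains a factor
    [2 ^ -((n - F) %/ q)], whose exponent, of order at least [q ^ 3], exceeds the cost
    [12 F ^ 2 + q + m] of the union bound. *)
Lemma coning_bound :
  (n.+1 ^ F * 2 ^ (2 ^ F) * (2 ^ F).-1 ^ (n - F) * 2 ^ m <= 2 ^ (F * (n - F)))%N.
Proof.
set q := (2 ^ F)%N; have q0 : (0 < q)%N by rewrite expn_gt0.
have F4 : (4 <= F)%N by apply: leq_trans m_lt_F; lia.
have Fq : (F < q)%N by exact: ltn_expl.
have FFq : (F ^ 2 <= q)%N by exact: sqr_le_exp2.
have nq : (q ^ 4 <= n)%N by rewrite -expnM mulnC.
have jle : (12 * F ^ 2 + q + m <= (n - F) %/ q)%N.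
  rewrite leq_divRL //.
  have q4 : (16 * q ^ 2 <= q ^ 4)%N.
    rewrite (expnD q 2 2 : (q ^ 4)%N = _) leq_mul2r; apply/orP; right.
    by rewrite -[16%N]/(4 ^ 2)%N leq_exp2r //; lia.
  have : ((12 * F ^ 2 + q + m) * q + F <= 16 * q ^ 2)%N by nia.
  lia.
apply: leq_trans (_ : (2 ^ ((n - F) %/ q) * q.-1 ^ (n - F) <= _)%N); last first.
  by rewrite mulnC expnM -/q; exact: pred_exp_le_div.
rewrite mulnAC leq_mul2r; apply/orP; right.
apply: (@leq_trans ((2 ^ (12 * F)) ^ F * 2 ^ q * 2 ^ m)).
  by rewrite !leq_mul2r leq_exp2r ?n_lt ?orbT //; lia.
rewrite -expnM -!expnD leq_exp2l //; apply: leq_trans jle.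
by rewrite -mulnA mulnn.
Qed.

End asymptotics.

(** * The probability estimate and the limit *)

Lemma subcomplex_dim_le n (X : {set {set 'I_n}}) d : subcomplex X ->
  ~~ [exists s in X, #|s| == d.+1] -> forall s, s \in X -> (#|s| <= d)%N.
Proof.
move=> cX /exists_inPn nX s sX; rewrite leqNgt; apply/negP => ds.
pose t := [set x in take d.+1 (enum s)]%SET.
have ct : #|t| = d.+1.
  by rewrite cardsE (card_uniqP _) ?take_uniq ?enum_uniq // size_takel -?cardE.
have /nX : t \in X.
  apply: (subcomplex_sub cX sX); first by rewrite -card_gt0 ct.
  by apply/fintype.subsetP => x; rewrite finset.inE => /mem_take; rewrite mem_enum.
by rewrite ct eqxx.
Qed.

(** Failure forces one of two events, a face of [2 m + 1] vertices or a small family that no vertex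
    cones off; each has probability at most [2 ^ -m]. *)
Lemma medial_prob_TC_compl (R : realType) n : (20 <= conn_rank n)%N ->
  0 <= 1 - medial_prob R [set X : {set {set 'I_n}} | TC_le R (realization R n X) 4]
    <= 2 / 2 ^+ conn_rank n.
Proof.
move=> m20; set A := [set X | _]; rewrite medial_probC medial_probE.
set S := [set w | _]%SET; set m := conn_rank n.
have P0 k : 0 < 2 ^+ k :> R by rewrite exprn_gt0.
apply/andP; split; first by rewrite divr_ge0 // ltW.
set k := (2 * m).+1; set F := (3 ^ m)%N.
pose E1 := [set w : {set {set 'I_n}} | [exists s in complex_of w, #|s| == k]]%SET.
pose E2 := [set w : {set {set 'I_n}} | ~~ `[< coning (complex_of w) F >]]%SET.
have SE : S \subset (E1 :|: E2)%SET.
  apply/fintype.subsetP => w; rewrite !finset.inE => /asboolP nA.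
  apply: contraT; rewrite negb_or => /andP[n1 /negPn/asboolP cw]; exfalso; apply: nA.
  have cX := subcomplex_complex_of w.
  rewrite /A /=; apply: (@TC_le_coning R n _ F m) => //.
  exact: subcomplex_dim_le.
have h1 : (#|E1| * 2 ^ m <= 2 ^ (2 ^ n))%N.
  rewrite -(leq_pmul2r (m := 2 ^ (2 ^ k).-1)) ?expn_gt0 //.
  rewrite mulnAC; apply: leq_trans (leq_mul (card_large_face n k) (leqnn _)) _.
  by rewrite mulnAC mulnC leq_mul2l large_face_bound ?orbT.
have h2 : (#|E2| * 2 ^ m <= 2 ^ (2 ^ n))%N.
  rewrite -(leq_pmul2r (m := 2 ^ (F * (n - F)))) ?expn_gt0 //.
  rewrite mulnAC.
  apply: leq_trans (leq_mul (card_not_coning (leq_F_n m20)) (leqnn _)) _.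
  rewrite mulnCA -mulnA leq_mul2l; apply/orP; right.
  exact: coning_bound.
rewrite ler_pdivrMr // mulrAC ler_pdivlMr // -!natrX -!natrM ler_nat.
apply: leq_trans (leq_mul (subset_leq_card SE) (leqnn _)) _.
apply: leq_trans (leq_mul (leq_card_setU _ _) (leqnn _)) _.
by rewrite mulnDl mul2n -addnn leq_add.
Qed.

Lemma conn_rank_ge M n : (2 ^ (4 * 3 ^ M) <= n)%N -> (M <= conn_rank n)%N.
Proof.
move=> h; apply: trunc_log_max => //; rewrite leq_divRL // mulnC.
exact: trunc_log_max.
Qed.

Theorem theorem8p1 (R : realType) :
  medial_prob R [set X : {set {set 'I_n}} | TC_le R (realization R n X) 4]
    @[n --> \oo] --> (1 : R).
Proof.
apply/cvgrPdist_lt => e e0.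
(* The bound 20 is what the estimates require, and [2 / e < M < 2 ^ M] makes the failure probability
   smaller than [e]. *)
pose M := maxn 20 (Num.truncn (2 / e)).+1.
exists (2 ^ (4 * 3 ^ M))%N => // n /= nM.
have Mm := conn_rank_ge nM.
have m20 : (20 <= conn_rank n)%N by apply: leq_trans Mm; exact: leq_maxl.
have /andP[b0 b1] := medial_prob_TC_compl R m20.
rewrite ger0_norm //; apply: le_lt_trans b1 _.
rewrite ltr_pdivrMr ?exprn_gt0 // -ltr_pdivrMl // mulrC.
apply: lt_le_trans (truncnS_gt _) _.
rewrite -natrX ler_nat; apply: leq_trans (_ : M <= _)%N; first exact: leq_maxr.
by apply: leq_trans Mm _; apply: ltnW; exact: ltn_expl.
Qed.
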